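(* For every pair of integers $k,h\geq 1$ there exists a polynomial $g_{k,h}(t)\in\mathbb{Z}[t]$ such that for every matroid $\mathsf{M}$ of rank $k$ having a stressed hyperplane $H$ with $|H|=h$, if $\widetilde{\mathsf{M}}$ denotes the relaxation of $\mathsf{M}$ at $H$, then $\gamma_{\widetilde{\mathsf{M}}}(t)=\gamma_{\mathsf{M}}(t)+g_{k,h}(t)$.
   Context: A hyperplane of a matroid of rank $k$ is a flat of rank $k-1$; it is stressed if all its subsets of cardinality $k$ are circuits. If $\mathsf{M}=(E,\mathscr{B})$ has a stressed hyperplane $H$, its relaxation at $H$ is the matroid $\widetilde{\mathsf{M}}=(E,\mathscr{B}\sqcup\{S\subseteq H:|S|=k\})$. For a matroid $\mathsf{M}$ with lattice of flats $\mathscr{L}(\mathsf{M})$ and flat $F$, $\mathsf{M}^F$ is the localization (matroid on $F$ whose flats are the flats of $\mathsf{M}$ contained in $F$) and $\mathsf{M}_F$ the contraction (matroid on $E\smallsetminus F$ whose flats are $F'\smallsetminus F$ for flats $F'\supseteq F$); $\chi_{\mathsf{M}}$ is the characteristic polynomial. The Kazhdan–Lusztig polynomial $P_{\mathsf{M}}(t)$ is the unique assignment such that: if $\operatorname{rk}(\mathsf{M})=0$ then $P_{\mathsf{M}}=1$ if the ground set is empty and $0$ otherwise; if $\operatorname{rk}(\mathsf{M})>0$ then $\deg P_{\mathsf{M}}<\operatorname{rk}(\mathsf{M})/2$; and $t^{\operatorname{rk}(\mathsf{M})}P_{\mathsf{M}}(t^{-1})=\sum_{F}\chi_{\mathsf{M}^F}(t)P_{\mathsf{M}_F}(t)$.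 The $Z$-polynomial is $Z_{\mathsf{M}}(t)=\sum_{F\in\mathscr{L}(\mathsf{M})}t^{\operatorname{rk}(F)}P_{\mathsf{M}_F}(t)$; it satisfies $Z_{\mathsf{M}}(t)=t^{\operatorname{rk}(\mathsf{M})}Z_{\mathsf{M}}(t^{-1})$. The $\gamma$-polynomial $\gamma_{\mathsf{M}}(t)=\sum_i\gamma_i t^i$ is the unique integer polynomial with $Z_{\mathsf{M}}(t)=\sum_{i=0}^{\lfloor \operatorname{rk}(\mathsf{M})/2\rfloor}\gamma_i t^i(1+t)^{\operatorname{rk}(\mathsf{M})-2i}$. *)

(* Defs.v *)
From HB Require Import structures.
From mathcomp Require Import all_boot all_order all_algebra.
From mathcomp Require Import zify.

Set Implicit Arguments.
Unset Strict Implicit.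
Unset Printing Implicit Defensive.

Import GRing.Theory.

Definition matroid_axiom (T : finType) (E : {set T}) (Bs : {set {set T}}) :=
  [&& Bs != set0,
      [forall B in Bs, B \subset E] &
      [forall B1 in Bs, forall B2 in Bs, forall x in B1 :\: B2,
         exists y in B2 :\: B1, y |: (B1 :\ x) \in Bs]].

(* A matroid (E, B) whose ground set E is a subset of the finite type T, so
   that all minors of a matroid live over the same T. *)
Record matroid (T : finType) := Matroid {
  matroid_val : {set T} * {set {set T}};
  _ : matroid_axiom matroid_val.1 matroid_val.2 }.

HB.instance Definition _ (T : finType) := [isSub for @matroid_val T].
HB.instance Definition _ (T : finType) := [Finite of matroid T by <:].

Definition ground (T : finType) (M : matroid T) : {set T} := (matroid_val M).1.
Definition bases (T : finType) (M : matroid T) : {set {set T}} :=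
  (matroid_val M).2.

Definition rk (T : finType) (M : matroid T) (A : {set T}) : nat :=
  \max_(B in bases M) #|A :&: B|.

Definition rank (T : finType) (M : matroid T) : nat := rk M (ground M).

Definition indep (T : finType) (M : matroid T) (A : {set T}) : bool :=
  [exists B in bases M, A \subset B].

Definition circuit (T : finType) (M : matroid T) (C : {set T}) : bool :=
  minset (fun D => (D \subset ground M) && ~~ indep M D) C.

Definition flats (T : finType) (M : matroid T) : {set {set T}} :=
  [set F : {set T} | (F \subset ground M) &&
     [forall x in ground M :\: F, rk M F < rk M (x |: F)]].

Definition hyperplane (T : finType) (M : matroid T) (H : {set T}) : bool :=
  (H \in flats M) && ((rk M H).+1 == rank M).

Definition stressed_hyperplane (T : finType) (M : matroid T) (H : {set T}) :=
  hyperplane M H &&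
  [forall S : {set T}, (S \subset H) && (#|S| == rank M) ==> circuit M S].

Lemma matroidP (T : finType) (M : matroid T) :
  matroid_axiom (ground M) (bases M).
Proof. by case: M. Qed.

Lemma bases_ex (T : finType) (M : matroid T) : exists B, B \in bases M.
Proof. by case/and3P: (matroidP M) => /set0Pn. Qed.

Lemma bases_sub (T : finType) (M : matroid T) B :
  B \in bases M -> B \subset ground M.
Proof. by case/and3P: (matroidP M) => _ /forall_inP + _; apply. Qed.

Lemma bases_exch (T : finType) (M : matroid T) B1 B2 x :
  B1 \in bases M -> B2 \in bases M -> x \in B1 -> x \notin B2 ->
  exists y, [/\ y \in B2, y \notin B1 & y |: (B1 :\ x) \in bases M].
Proof.
case/and3P: (matroidP M) => _ _ /forall_inP ex h1 h2 x1 x2.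
have /forall_inP/(_ x) := forall_inP (ex _ h1) _ h2.
rewrite !inE x1 x2 => /(_ isT)/exists_inP[y]; rewrite inE => /andP[y1 y2] h.
by exists y.
Qed.

Lemma matroid_axiomI (T : finType) (E : {set T}) (Bs : {set {set T}}) :
  (exists B, B \in Bs) -> (forall B, B \in Bs -> B \subset E) ->
  (forall B1 B2 x, B1 \in Bs -> B2 \in Bs -> x \in B1 -> x \notin B2 ->
   exists y, [/\ y \in B2, y \notin B1 & y |: (B1 :\ x) \in Bs]) ->
  matroid_axiom E Bs.
Proof.
move=> ne sub ex; apply/and3P; split; first exact/set0Pn.
  exact/forall_inP.
apply/forall_inP => B1 h1; apply/forall_inP => B2 h2; apply/forall_inP => x.
rewrite inE => /andP[x2 x1]; have [y [y2 y1 hy]] := ex _ _ _ h1 h2 x1 x2.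
by apply/exists_inP; exists y => //; rewrite inE y1.
Qed.

Lemma card_exch (T : finType) (B : {set T}) x y :
  x \in B -> y \notin B -> #|y |: (B :\ x)| = #|B|.
Proof.
move=> xB yB; rewrite cardsU1 (cardsD1 x B) xB.
by rewrite !inE (negPf yB) andbF.
Qed.

Lemma card_bases (T : finType) (M : matroid T) B1 B2 :
  B1 \in bases M -> B2 \in bases M -> #|B1| = #|B2|.
Proof.
move=> + h2; have [n] := ubnP #|B1 :\: B2|.
elim: n B1 => // n IH B1 le h1.
have [/eqP|/set0Pn[x]] := eqVneq (B1 :\: B2) set0.
  rewrite setD_eq0 => s12; suff /eqP <- : B1 == B2 by [].
  rewrite eqEsubset s12; apply/subsetP => x x2; apply/negPn/negP => x1.
  have [y [y1]] := bases_exch h2 h1 x2 x1.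
  by rewrite (subsetP s12 _ y1).
rewrite inE => /andP[x2 x1]; have [y [y2 y1 hy]] := bases_exch h1 h2 x1 x2.
rewrite -(card_exch x1 y1); apply: (IH _ _ hy); rewrite ltnS in le.
apply: leq_trans le; apply: proper_card; apply/properP; split.
  apply/subsetP => z; rewrite !inE => /andP[z2 /orP[/eqP zy|/andP[_ ->]]] //.
    by rewrite zy y2 in z2.
  by rewrite z2.
exists x; rewrite !inE ?x1 ?x2 // eqxx /= orbF.
by apply/eqP => xy; rewrite xy y2 in x2.
Qed.

Lemma bases_ext (T : finType) (M : matroid T) (I B1 B2 : {set T}) :
  B1 \in bases M -> B2 \in bases M -> I \subset B1 ->
  exists B, [/\ B \in bases M, I \subset B & B \subset I :|: B2].
Proof.
move=> + h2; have [n] := ubnP #|B1 :\: (I :|: B2)|.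
elim: n B1 => // n IH B1 le h1 sI.
have [/eqP|/set0Pn[x]] := eqVneq (B1 :\: (I :|: B2)) set0.
  by rewrite setD_eq0 => s12; exists B1.
rewrite !inE negb_or => /andP[/andP[xI x2] x1].
have [y [y2 y1 hy]] := bases_exch h1 h2 x1 x2.
apply: (IH _ _ hy); last first.
  apply/subsetP => z zI; rewrite !inE (subsetP sI) // andbT.
  by apply/orP; right; apply/eqP => zx; rewrite -zx zI in xI.
rewrite ltnS in le; apply: leq_trans le; apply: proper_card; apply/properP; split.
  apply/subsetP => z; rewrite !inE => /andP[z2 /orP[/eqP zy|/andP[_ ->]]] //.
    by rewrite zy y2 orbT in z2.
  by rewrite z2.
exists x; rewrite !inE ?x1 ?(negPf x2) ?(negPf xI) // eqxx /= orbF.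
by apply/eqP => xy; rewrite xy y2 in x2.
Qed.

Lemma rk_ge (T : finType) (M : matroid T) A B :
  B \in bases M -> #|A :&: B| <= rk M A.
Proof. by move=> hB; rewrite /rk (bigmax_sup B). Qed.

Lemma rk_ex (T : finType) (M : matroid T) A :
  exists2 B, B \in bases M & #|A :&: B| = rk M A.
Proof.
have [B0 h0] := bases_ex M.
rewrite /rk (bigmax_eq_arg B0 h0); case: arg_maxnP => // B hB _.
by exists B.
Qed.

Lemma rk_nested (T : finType) (M : matroid T) (A1 A2 : {set T}) :
  A1 \subset A2 ->
  exists B, [/\ B \in bases M, #|A1 :&: B| = rk M A1 & #|A2 :&: B| = rk M A2].
Proof.
move=> s12; have [B1 h1 r1] := rk_ex M A1; have [B2 h2 r2] := rk_ex M A2.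
have [B [hB s1 s2]] := bases_ext h1 h2 (subsetIr A1 B1).
exists B; split=> //; apply/eqP; rewrite eqn_leq rk_ge //=.
  by rewrite -r1 subset_leq_card // subsetI subsetIl.
have sD : B :\: A2 \subset B2 :\: A2.
  apply/subsetP => x; rewrite !inE => /andP[x2 xB]; rewrite x2 /=.
  have := subsetP s2 x xB; rewrite !inE => /orP[/andP[/(subsetP s12)]|] //.
  by rewrite (negPf x2).
have := subset_leq_card sD; have := card_bases hB h2.
rewrite -(cardsID A2 B) -(cardsID A2 B2) -r2 ![_ :&: A2]setIC; lia.
Qed.

Lemma bases_swap (T : finType) (M : matroid T) (F B1 B2 : {set T}) :
  B1 \in bases M -> B2 \in bases M ->
  #|F :&: B1| = rk M F -> #|F :&: B2| = rk M F ->
  (F :&: B1) :|: (B2 :\: F) \in bases M.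
Proof.
move=> h1 h2 r1 r2.
have [B [hB s1 s2]] := bases_ext h1 h2 (subsetIr F B1).
have eF : F :&: B1 = F :&: B.
  apply/eqP; rewrite eqEcard subsetI subsetIl s1 /=.
  by rewrite r1 rk_ge.
have eD : B :\: F = B2 :\: F.
  apply/eqP; rewrite eqEcard; apply/andP; split.
    apply/subsetP => x; rewrite !inE => /andP[xF xB]; rewrite xF /=.
    by have := subsetP s2 x xB; rewrite !inE (negPf xF).
  have := card_bases hB h2; rewrite -(cardsID F B) -(cardsID F B2).
  rewrite ![_ :&: F]setIC -eF r1 r2; lia.
by rewrite eF -eD setIC setID.
Qed.

Lemma localization_axiom (T : finType) (M : matroid T) (F : {set T}) :
  matroid_axiom (ground M :&: F)
    [set F :&: B | B in bases M & #|F :&: B| == rk M F].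
Proof.
apply: matroid_axiomI.
- have [B hB rB] := rk_ex M F; exists (F :&: B).
  by apply: imset_f; rewrite inE hB rB eqxx.
- move=> _ /imsetP[B /[!inE] /andP[hB _] ->].
  by rewrite setIC setSI // bases_sub.
move=> C1 C2 x /imsetP[B1 /[!inE] /andP[h1 /eqP r1] ->].
move=> /imsetP[B2 /[!inE] /andP[h2 /eqP r2] ->] /[!inE] /andP[xF x1].
rewrite xF /= => x2.
have h3 := bases_swap h2 h1 r2 r1.
have [|y [y3 y1 hy]] := bases_exch h1 h3 x1.
  by rewrite !inE xF (negPf x2).
have yF : y \in F by move: y3; rewrite !inE (negPf y1) andbF orbF; case/andP.
have e : y |: (F :&: B1) :\ x = F :&: (y |: B1 :\ x).
  apply/setP => z; rewrite !inE; case: (eqVneq z y) => [->|_] /=.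
    by rewrite yF.
  by rewrite andbCA.
exists y; split; rewrite ?inE ?yF //.
  by move: y3; rewrite !inE (negPf y1) andbF orbF; case/andP.
rewrite e; apply: imset_f; rewrite inE hy -e card_exch ?r1 ?eqxx //.
  by rewrite inE xF.
by rewrite inE yF.
Qed.

(* M^F, the restriction of M to F. *)
Definition localization (T : finType) (M : matroid T) (F : {set T}) :=
  @Matroid T (_, _) (localization_axiom M F).

Lemma contraction_axiom (T : finType) (M : matroid T) (F : {set T}) :
  matroid_axiom (ground M :\: F)
    [set B :\: F | B in bases M & #|F :&: B| == rk M F].
Proof.
apply: matroid_axiomI.
- have [B hB rB] := rk_ex M F; exists (B :\: F).
  by apply: imset_f; rewrite inE hB rB eqxx.
- move=> _ /imsetP[B /[!inE] /andP[hB _] ->].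
  by rewrite setSD // bases_sub.
move=> C1 C2 x /imsetP[B1 /[!inE] /andP[h1 /eqP r1] ->].
move=> /imsetP[B2 /[!inE] /andP[h2 /eqP r2] ->] /[!inE] /andP[xF x1].
rewrite xF /= => x2.
have h3 := bases_swap h2 h1 r2 r1.
have [|y [y2 y3 hy]] := bases_exch h3 h2 _ x2.
  by rewrite !inE xF x1 orbT.
move: y3; rewrite !inE y2 andbT negb_or => /andP[yF]; rewrite yF /= => y1.
exists y; split; rewrite ?inE ?yF //.
apply/imsetP; exists (y |: (F :&: B2 :|: B1 :\: F) :\ x).
  rewrite inE hy -r2; apply/eqP/eq_card => z; rewrite !inE.
  case: (boolP (z \in F)) => //= zF; rewrite orbF.
  case: eqVneq => [zy|_] /=; first by rewrite zy (negPf yF) in zF.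
  by case: eqVneq => [zx|//]; rewrite zx (negPf xF) in zF.
apply/setP => z; rewrite !inE.
case: eqVneq => [->|_] /=; first by rewrite yF.
by case: (z \in F); rewrite /= ?andbF.
Qed.

(* M_F; this is M / F in the usual notation for contractions. *)
Definition contraction (T : finType) (M : matroid T) (F : {set T}) :=
  @Matroid T (_, _) (contraction_axiom M F).

Lemma rank_bases (T : finType) (M : matroid T) B :
  B \in bases M -> rank M = #|B|.
Proof.
move=> hB; rewrite /rank; have [C hC <-] := rk_ex M (ground M).
by rewrite (setIidPr (bases_sub hC)); apply: card_bases hC hB.
Qed.

Lemma rk_indep (T : finType) (M : matroid T) A : indep M A -> rk M A = #|A|.
Proof.
move=> /exists_inP[B hB sAB]; apply/eqP; rewrite eqn_leq; apply/andP; split.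
  by have [C _ <-] := rk_ex M A; rewrite subset_leq_card ?subsetIl.
by rewrite -{1}(setIidPl sAB) rk_ge.
Qed.

Lemma rk_sub (T : finType) (M : matroid T) (A A' : {set T}) :
  A \subset A' -> rk M A <= rk M A'.
Proof.
move=> s; have [B hB <-] := rk_ex M A.
by apply: leq_trans (rk_ge _ hB); rewrite subset_leq_card // setSI.
Qed.

Lemma circuitD1 (T : finType) (M : matroid T) C x :
  circuit M C -> x \in C -> indep M (C :\ x).
Proof.
move=> /minsetP[/andP[sC _] mC] xC; case: (boolP (indep M _)) => // n.
suff /setP/(_ x) : C :\ x = C by rewrite !inE eqxx xC.
by apply: mC; rewrite ?n ?subD1set // (subset_trans (subD1set _ _)).
Qed.

Lemma stressed_basis (T : finType) (M : matroid T) (H S : {set T}) x e :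
  stressed_hyperplane M H -> S \subset H -> #|S| = rank M ->
  x \in S -> e \in ground M :\: H -> e |: (S :\ x) \in bases M.
Proof.
move=> /andP[/andP[/[!inE] /andP[_ /forall_inP fl] /eqP rH] /forallP st] sS cS.
move=> xS eH.
have /circuitD1/(_ xS) iS : circuit M S.
  by have /implyP := st S; apply; rewrite sS cS /=.
have cSx : #|S :\ x| = rk M H by move: cS; rewrite (cardsD1 x) xS -rH; lia.
have/exists_inP[B1 h1 s1] := iS.
have sSx : S :\ x \subset H by rewrite (subset_trans (subD1set _ _)).
have r1 : H :&: B1 = S :\ x.
  apply/esym/eqP; rewrite eqEcard subsetI sSx s1 /=.
  by rewrite cSx rk_ge.
have [B2 [h2 r2 r2']] := rk_nested M (subsetU1 e H).
have e2 : e \in B2.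
  apply/negPn/negP => e2; have := fl e; rewrite inE => /(_ eH); rewrite -r2 -r2'.
  rewrite (_ : (e |: H) :&: B2 = H :&: B2) ?ltnn //.
  apply/setP => z; rewrite !inE; case: eqVneq => [->|//].
  by rewrite (negPf e2) !andbF.
have := bases_swap h1 h2 _ r2; rewrite r1 => /(_ cSx).
suff -> : B2 :\: H = [set e] by rewrite setUC.
apply/esym/eqP; rewrite eqEcard sub1set !inE e2 cards1 andbT.
case/andP: eH => -> _ /=.
have := rank_bases h2; rewrite -(cardsID H B2) setIC r2; lia.
Qed.

Lemma relaxation_axiom (T : finType) (M : matroid T) (H : {set T}) :
  stressed_hyperplane M H ->
  matroid_axiom (ground M)
    (bases M :|: [set S : {set T} | (S \subset H) && (#|S| == rank M)]).
Proof.
move=> sH; have /andP[/andP[/[!inE] /andP[HE _] /eqP rH] _] := sH.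
apply: matroid_axiomI.
- by have [B hB] := bases_ex M; exists B; rewrite inE hB.
- move=> B; rewrite !inE => /orP[/bases_sub //|/andP[sB _]].
  exact: subset_trans sB HE.
move=> B1 B2 x; rewrite !inE => h1 h2 x1 x2.
have c1 : #|B1| = rank M.
  by case/orP: h1 => [/rank_bases ->//|/andP[_ /eqP]].
have c2 : #|B2| = rank M.
  by case/orP: h2 => [/rank_bases ->//|/andP[_ /eqP]].
case/orP: h1 => [h1|/andP[s1 _]]; last first.
  case: (boolP [exists y in B2 :\: B1, y \in H]).
    move=> /exists_inP[y]; rewrite inE => /andP[y1 y2] yH; exists y.
    split=> //; rewrite !inE card_exch // c1 eqxx andbT.
    rewrite subUset sub1set yH /= (subset_trans _ s1) ?orbT //.
    exact: subD1set.
  move=> /exists_inPn no.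
  have [y y2 y1] : exists2 y, y \in B2 & y \notin B1.
    apply/subsetPn; apply/negP => s21; have /eqP e : B2 == B1.
      by rewrite eqEcard s21 c1 c2 leqnn.
    by rewrite e x1 in x2.
  exists y; split=> //; rewrite inE (stressed_basis sH) //.
  rewrite inE no ?inE ?y1 ?y2 //=.
  by case/orP: h2 => [/bases_sub/subsetP->//|/andP[/subsetP/(_ y y2) yH _]];
     rewrite (subsetP HE).
case/orP: h2 => [h2|/andP[s2 _]].
  have [y [y2 y1 hy]] := bases_exch h1 h2 x1 x2.
  by exists y; split=> //; rewrite inE hy.
have [y y2 y1] : exists2 y, y \in B2 & y \notin B1.
  apply/subsetPn; apply/negP => s21; have /eqP e : B2 == B1.
    by rewrite eqEcard s21 c1 c2 leqnn.
  by rewrite e x1 in x2.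
case: (boolP (B1 :\ x \subset H)) => [s1|].
  exists y; split=> //; rewrite !inE card_exch // c1 eqxx andbT.
  by rewrite subUset sub1set s1 (subsetP s2) ?orbT.
case/subsetPn => e; rewrite !inE => /andP[ex e1] eH.
have eE : e \in ground M :\: H by rewrite inE eH (subsetP (bases_sub h1)).
have h3 := stressed_basis sH s2 c2 y2 eE.
have [|z [z3 z1 hz]] := bases_exch h1 h3 x1.
  by rewrite !inE (negPf x2) andbF orbF eq_sym.
exists z; split=> //; last by rewrite inE hz.
move: z3; rewrite !inE => /orP[/eqP ze|/andP[]//].
by rewrite ze e1 in z1.
Qed.

Definition relaxation (T : finType) (M : matroid T) (H : {set T})
    (sH : stressed_hyperplane M H) :=
  @Matroid T (_, _) (relaxation_axiom sH).
Lemma rk0 (T : finType) (M : matroid T) : rk M set0 = 0.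
Proof. by have [B _ <-] := rk_ex M set0; rewrite set0I cards0. Qed.

Lemma rk_ground (T : finType) (M : matroid T) A :
  rk M (ground M :&: A) = rk M A.
Proof.
apply: eq_bigr => B hB; congr #|pred_of_set _|.
by rewrite setIAC setIC (setIidPr (bases_sub hB)).
Qed.

Lemma rk_le_rank (T : finType) (M : matroid T) A : rk M A <= rank M.
Proof. by rewrite -rk_ground rk_sub ?subsetIl. Qed.

Lemma rk_submod (T : finType) (M : matroid T) A B :
  rk M (A :|: B) + rk M (A :&: B) <= rk M A + rk M B.
Proof.
have sIU : A :&: B \subset A :|: B.
  by rewrite (subset_trans (subsetIl _ _)) ?subsetUl.
have [C [hC <- <-]] := rk_nested M sIU.
rewrite setIUl setIIl cardsUI.
by rewrite leq_add ?rk_ge.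
Qed.

Lemma basesE (T : finType) (M : matroid T) B :
  (B \in bases M) = [&& B \subset ground M, #|B| == rank M & rk M B == #|B|].
Proof.
apply/idP/and3P => [hB|[sB /eqP cB /eqP rB]].
  split; rewrite ?bases_sub // ?(rank_bases hB) //.
  by rewrite rk_indep //; apply/exists_inP; exists B.
have [C hC eC] := rk_ex M B.
suff -> : B = C by [].
have /eqP BC : B :&: C == B by rewrite eqEcard subsetIl eC rB leqnn.
apply/eqP; rewrite eqEcard -(rank_bases hC) cB leqnn andbT.
by rewrite -BC subsetIr.
Qed.

Lemma matroid_eq (T : finType) (M N : matroid T) :
  ground M = ground N -> rk M =1 rk N -> M = N.
Proof.
move=> eE er; apply: val_inj => /=.
rewrite [matroid_val M]surjective_pairing [matroid_val N]surjective_pairing.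
congr pair => //; apply/setP => B.
by rewrite -!/(bases _) !basesE /rank eE !er.
Qed.

Lemma rk_localization (T : finType) (M : matroid T) F A :
  rk (localization M F) A = rk M (A :&: F).
Proof.
apply/eqP; rewrite eqn_leq; apply/andP; split.
  apply/bigmax_leqP => _ /imsetP[B /[!inE] /andP[hB _] ->].
  by rewrite setIA rk_ge.
have [B [hB rA rF]] := rk_nested M (subsetIr A F).
rewrite -rA -setIA rk_ge //; apply: imset_f.
by rewrite inE hB rF eqxx.
Qed.

Lemma rk_contraction (T : finType) (M : matroid T) F A :
  rk (contraction M F) A + rk M F = rk M (A :|: F).
Proof.
have cE (B : {set T}) : #|A :&: (B :\: F)| + #|F :&: B| = #|(A :|: F) :&: B|.
  rewrite -(cardsID F ((A :|: F) :&: B)) addnC; congr (_ + _); apply: eq_card.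
    move=> z; rewrite !inE; by case: (z \in F); rewrite ?orbT ?andbF ?andbT.
  by move=> z; rewrite !inE; case: (z \in F); rewrite ?andbF ?orbF.
apply/eqP; rewrite eqn_leq; apply/andP; split.
  have [_ /imsetP[B /[!inE] /andP[hB /eqP <-] ->] <-] :=
    rk_ex (contraction M F) A.
  by rewrite cE rk_ge.
have [B [hB rF rA]] := rk_nested M (subsetUr A F).
rewrite -rA -cE rF leq_add2r rk_ge //; apply: imset_f.
by rewrite inE hB rF eqxx.
Qed.

Lemma rank_localization (T : finType) (M : matroid T) (F : {set T}) :
  rank (localization M F) = rk M F.
Proof. by rewrite /rank rk_localization -setIA setIid rk_ground. Qed.

Lemma rank_contraction (T : finType) (M : matroid T) (F : {set T}) :
  rank (contraction M F) + rk M F = rank M.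
Proof.
rewrite /rank rk_contraction -[rk M (_ :|: _)]rk_ground; congr (rk M _).
by apply/setP => z; rewrite !inE; case: (z \in F); case: (z \in ground M).
Qed.

Lemma setDUsub (T : finType) (F G : {set T}) :
  F \subset G -> G :\: F :|: F = G.
Proof. by move=> s; rewrite -[RHS](setID _ F) (setIidPr s) setUC. Qed.

Lemma contraction_contraction (T : finType) (M : matroid T) (F G : {set T}) :
  F \subset G -> contraction (contraction M F) (G :\: F) = contraction M G.
Proof.
move=> sFG; apply: matroid_eq.
  apply/setP => z; rewrite !inE; have := subsetP sFG z.
  by case: (z \in F) => /= [->|_]; rewrite ?andbF.
move=> A; apply/eqP; rewrite -(eqn_add2r (rk M G)) rk_contraction.
have := rk_contraction (contraction M F) (G :\: F) A.
have := rk_contraction M F (A :|: G :\: F).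
have := rk_contraction M F (G :\: F).
have -> : A :|: G :\: F :|: F = A :|: G.
  by rewrite -setUA setDUsub.
by rewrite setDUsub //; lia.
Qed.

Lemma contraction_localization (T : finType) (M : matroid T) (F G : {set T}) :
  F \subset G ->
  localization (contraction M F) (G :\: F) = contraction (localization M G) F.
Proof.
move=> sFG; apply: matroid_eq.
  apply/setP => z; rewrite !inE; case: (z \in F); rewrite ?andbF //=.
move=> A; rewrite rk_localization; apply/eqP.
rewrite -(eqn_add2r (rk (localization M G) F)) rk_contraction.
rewrite !rk_localization (setIidPl sFG) rk_contraction; apply/eqP.
congr (rk M _); apply/setP => z; rewrite !inE.
by have := subsetP sFG z; case: (z \in F) => [->|_]; rewrite ?orbT ?orbF.
Qed.

Lemma localization_localization (T : finType) (M : matroid T) (F G : {set T}) :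
  F \subset G -> localization (localization M G) F = localization M F.
Proof.
move=> sFG; apply: matroid_eq => [|A].
  by rewrite /ground /= -setIA (setIidPr sFG).
by rewrite !rk_localization -setIA (setIidPl sFG).
Qed.

Lemma contraction0 (T : finType) (M : matroid T) : contraction M set0 = M.
Proof.
apply: matroid_eq => [|A]; first by rewrite /ground /= setD0.
by have := rk_contraction M set0 A; rewrite setU0 rk0 addn0.
Qed.

Lemma flatP (T : finType) (M : matroid T) (F : {set T}) :
  reflect (F \subset ground M /\
           forall x, x \in ground M -> rk M (x |: F) = rk M F -> x \in F)
          (F \in flats M).
Proof.
rewrite inE; apply: (iffP andP) => -[sF h]; split=> //.
  move=> x xE e; apply/negPn/negP => xF; have /forall_inP/(_ x) := h.
  by rewrite inE xF xE e ltnn => /(_ isT).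
apply/forall_inP => x /[!inE] /andP[xF xE].
rewrite ltn_neqAle rk_sub ?subsetU1 // andbT eq_sym.
by apply/eqP => /h; rewrite (negPf xF) => /(_ xE).
Qed.

Lemma flat_sub (T : finType) (M : matroid T) (F : {set T}) :
  F \in flats M -> F \subset ground M.
Proof. by case/flatP. Qed.

Lemma flats_localization (T : finType) (M : matroid T) (F : {set T}) :
  F \in flats M ->
  flats (localization M F) = [set G in flats M | G \subset F].
Proof.
move=> /flatP[sF hF]; apply/setP => G; rewrite [in RHS]inE.
apply/flatP/andP => [[sG hG]|[/flatP[sG hG] sGF]].
  move: sG; rewrite subsetI => /andP[sGE sGF]; split=> //.
  apply/flatP; split=> // x xE e; apply: hG; last first.
    rewrite !rk_localization (setIidPl sGF) setIUl (setIidPl sGF).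
    apply/eqP; rewrite eqn_leq [X in _ && X]rk_sub ?subsetUr // andbT -e.
    by rewrite rk_sub // setSU // subsetIl.
  rewrite inE xE hF //; apply/eqP.
  rewrite eqn_leq [X in _ && X]rk_sub ?subsetU1 // andbT.
  have := rk_submod M (x |: G) F; rewrite -setUA (setUidPr sGF) e.
  have : rk M G <= rk M ((x |: G) :&: F).
    by rewrite rk_sub // subsetI subsetUr.
  lia.
split; first by rewrite subsetI sG.
move=> x /[!inE] /andP[xE xF]; rewrite !rk_localization (setIidPl sGF).
by rewrite (setIidPl _) ?subUset ?sub1set ?xF //; apply: hG.
Qed.

Lemma flats_contraction_sub (T : finType) (M : matroid T) (F G : {set T}) :
  G \in flats M -> F \subset G -> G :\: F \in flats (contraction M F).
Proof.
move=> /flatP[sG hG] sFG; apply/flatP; split; first exact: setSD.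
move=> x /[!inE] /andP[xF xE] e; rewrite xF /=; apply: hG => //.
have := rk_contraction M F (G :\: F); rewrite -e rk_contraction.
by rewrite -setUA setDUsub.
Qed.

Lemma flats_contractionU (T : finType) (M : matroid T) (F G : {set T}) :
  F \in flats M -> G \in flats (contraction M F) -> G :|: F \in flats M.
Proof.
move=> /flatP[sF hF] /flatP[sG hG]; apply/flatP; split.
  by rewrite subUset sF (subset_trans sG) ?subsetDl.
move=> x xE e; rewrite inE; case: (boolP (x \in F)) => xF.
  by rewrite orbT.
rewrite orbF; apply: hG; first by rewrite inE xF xE.
apply/eqP; rewrite -(eqn_add2r (rk M F)) !rk_contraction.
by rewrite -setUA e.
Qed.

Lemma flats_contraction (T : finType) (M : matroid T) (F : {set T}) :
  F \in flats M ->
  flats (contraction M F) = [set G :\: F | G in flats M & F \subset G].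
Proof.
move=> hF; apply/setP => G; apply/idP/imsetP => [hG|[G' + ->]].
  exists (G :|: F); first by rewrite inE flats_contractionU // subsetUr.
  rewrite setDUl setDv setU0; apply/esym/setDidPl.
  by have := flat_sub hG; rewrite subsetD => /andP[].
by rewrite inE => /andP[hG' sF]; apply: flats_contraction_sub.
Qed.
Definition closure (T : finType) (M : matroid T) (A : {set T}) : {set T} :=
  [set x in ground M | rk M (x |: A) == rk M A].

Lemma sub_closure (T : finType) (M : matroid T) (A : {set T}) :
  A \subset ground M -> A \subset closure M A.
Proof.
move=> sA; apply/subsetP => x xA; rewrite inE (subsetP sA) //=.
by rewrite (setUidPr _) // sub1set.
Qed.

Lemma rk_closure (T : finType) (M : matroid T) (A : {set T}) :
  A \subset ground M -> rk M (closure M A) = rk M A.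
Proof.
move=> sA; have sAc := sub_closure sA.
apply/eqP; rewrite eqn_leq [X in _ && X]rk_sub // andbT leqNgt.
have [B [hB rA rc]] := rk_nested M sAc.
rewrite -rA -rc; apply/negP => lt.
have /subsetPn[x] : ~~ (closure M A :&: B \subset A :&: B).
  by apply/negP => /subset_leq_card; rewrite leqNgt lt.
rewrite !inE => /andP[/andP[_ /eqP e] xB]; rewrite xB andbT => xA.
have := rk_ge (x |: A) hB; rewrite e -rA setIUl (setIidPl _) ?sub1set //.
by rewrite cardsU1 inE (negPf xA) add1n ltnn.
Qed.

Lemma closure_flat (T : finType) (M : matroid T) (A : {set T}) :
  A \subset ground M -> closure M A \in flats M.
Proof.
move=> sA; apply/flatP; split.
  by apply/subsetP => x; rewrite inE => /andP[].
move=> x xE; rewrite rk_closure // => e; rewrite inE xE eqn_leq /=.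
rewrite [X in _ && X]rk_sub ?subsetU1 // andbT -e rk_sub // setUS //.
exact: sub_closure.
Qed.

Lemma closure_min (T : finType) (M : matroid T) (A F : {set T}) :
  A \subset ground M -> F \in flats M ->
  (closure M A \subset F) = (A \subset F).
Proof.
move=> sA /flatP[sF hF]; apply/idP/idP => [|sAF].
  exact/subset_trans/sub_closure.
apply/subsetP => x; rewrite inE => /andP[xE /eqP e]; apply: hF => //.
apply/eqP; rewrite eqn_leq [X in _ && X]rk_sub ?subsetU1 // andbT.
have := rk_submod M (x |: A) F; rewrite -setUA (setUidPr sAF) e.
have : rk M A <= rk M ((x |: A) :&: F) by rewrite rk_sub // subsetI subsetUr.
lia.
Qed.

Lemma ground_flat (T : finType) (M : matroid T) : ground M \in flats M.
Proof. by apply/flatP; split. Qed.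

Local Open Scope ring_scope.

(* This form of the characteristic polynomial also covers matroids with loops,
   for which it is 0 (charpoly_loop). *)
Definition charpoly (T : finType) (M : matroid T) : {poly int} :=
  \sum_(A in powerset (ground M)) (-1) ^+ #|A| * 'X^(rank M - rk M A).

Lemma sum_sign_powerset (T : finType) (R : comNzRingType) (D : {set T}) :
  \sum_(B in powerset D) (-1) ^+ #|B| = (D == set0)%:R :> R.
Proof.
transitivity (\prod_(i : T) ((if i \in D then -1 else 0) + 1) : R); last first.
  have [->|/set0Pn[x xD]] := eqVneq D set0.
    by rewrite big1 // => i _; rewrite inE add0r.
  by rewrite (bigD1 x) //= xD addNr mul0r.
rewrite bigA_distr big_mkcond; apply: eq_bigr => B _; rewrite inE.
case: ifPn => [sB|/subsetPn[x xB xD]]; last first.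
  by rewrite (bigD1 x) //= xB (negPf xD) mul0r.
rewrite -prodr_const [LHS]big_mkcond; apply: eq_bigr => x _.
by case: ifP => // xB; rewrite (subsetP sB).
Qed.

Lemma sum_inverseC (I : finType) (R : comUnitRingType) (S : {set I})
    (f g : I -> I -> R) :
  (forall i k, i \in S -> k \in S ->
     \sum_(j in S) f i j * g j k = (i == k)%:R) ->
  forall i k, i \in S -> k \in S ->
     \sum_(j in S) g i j * f j k = (i == k)%:R.
Proof.
move=> fg i k iS kS.
pose A := \matrix_(i < #|S|, j < #|S|) f (enum_val i) (enum_val j).
pose B := \matrix_(i < #|S|, j < #|S|) g (enum_val i) (enum_val j).
have /mulmx1C/matrixP : A *m B = 1%:M.
  apply/matrixP => a b; rewrite !mxE -(inj_eq enum_val_inj).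
  rewrite -fg ?enum_valP // [RHS]big_enum_val /=.
  by apply: eq_bigr => j _; rewrite !mxE.
move=> /(_ (enum_rank_in iS i) (enum_rank_in iS k)); rewrite !mxE.
rewrite -(inj_eq enum_val_inj) !enum_rankK_in // => <-.
rewrite [LHS]big_enum_val /=.
by apply: eq_bigr => j _; rewrite !mxE !enum_rankK_in.
Qed.

Definition flat_mu (T : finType) (M : matroid T) (F G : {set T}) : {poly int} :=
  \sum_(B in powerset (ground M :\: F) | closure M (B :|: F) == G)
     (-1) ^+ #|B|.

Lemma charpoly_contraction (T : finType) (M : matroid T) (F : {set T}) :
  F \in flats M ->
  charpoly (contraction M F) =
  \sum_(G in flats M) flat_mu M F G * 'X^(rank M - rk M G).
Proof.
move=> hF; rewrite /charpoly.
have sUE (B : {set T}) : B \in powerset (ground M :\: F) ->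
    B :|: F \subset ground M.
  rewrite inE subsetD => /andP[sB _].
  by rewrite subUset sB (flat_sub hF).
rewrite (partition_big (fun B => closure M (B :|: F)) (mem (flats M))) /=;
  last by move=> B hB; apply/closure_flat/sUE.
apply: eq_bigr => G _; rewrite mulr_suml; apply: eq_bigr => B /andP[hB /eqP<-].
congr (_ * 'X^_); rewrite rk_closure ?sUE //.
have := rk_contraction M F B; have := rank_contraction M F; lia.
Qed.

Lemma flat_muP (T : finType) (M : matroid T) (F H : {set T}) :
  F \in flats M -> H \in flats M ->
  \sum_(G in flats M) flat_mu M F G * (G \subset H)%:R = (F == H)%:R.
Proof.
move=> hF hH.
have sUE (B : {set T}) : B \in powerset (ground M :\: F) ->
    B :|: F \subset ground M.
  rewrite inE subsetD => /andP[sB _].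
  by rewrite subUset sB (flat_sub hF).
transitivity (\sum_(B in powerset (ground M :\: F))
   (-1) ^+ #|B| * (B :|: F \subset H)%:R : {poly int}).
  rewrite [RHS](partition_big (fun B => closure M (B :|: F))
    (mem (flats M))) /=; last by move=> B hB; apply/closure_flat/sUE.
  apply: eq_bigr => G hG; rewrite mulr_suml.
  apply: eq_bigr => B /andP[hB /eqP<-].
  by rewrite closure_min ?sUE.
have [sFH|nFH] := boolP (F \subset H); last first.
  rewrite big1 => [|B _].
    by case: eqVneq nFH => [->|//]; rewrite subxx.
  by rewrite subUset (negPf nFH) andbF mulr0.
have -> : (F == H) = (H :\: F == set0).
  by rewrite setD_eq0 eqEsubset sFH.
rewrite -sum_sign_powerset big_mkcond [RHS]big_mkcond /=.
apply: eq_bigr => B _; rewrite !inE !subsetD subUset sFH andbT.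
have := flat_sub hH; case: (boolP (B \subset H)) => [sB sH|_ _] /=.
  by rewrite (subset_trans sB sH) mulr1.
by rewrite mulr0 if_same.
Qed.

Lemma sum_charpoly_contraction (T : finType) (M : matroid T) (A : {set T}) :
  A \subset ground M ->
  \sum_(F in flats M | A \subset F) charpoly (contraction M F) =
  'X^(rank M - rk M A).
Proof.
move=> sA.
transitivity (\sum_(G in flats M) (\sum_(F in flats M)
    (closure M A \subset F)%:R * flat_mu M F G) * 'X^(rank M - rk M G)).
  under [RHS]eq_bigr do rewrite mulr_suml.
  rewrite exchange_big big_mkcondr /=; apply: eq_bigr => F hF.
  rewrite closure_min //; case: ifP => _; last first.
    by rewrite big1 // => G _; rewrite !mul0r.
  rewrite charpoly_contraction //; apply: eq_bigr => G _.
  by rewrite mul1r.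
have hc := closure_flat sA.
rewrite (bigD1 (closure M A)) //= [X in _ + X]big1 => [|G /andP[hG nG]].
  rewrite (sum_inverseC (flat_muP (M := M))) // eqxx mul1r addr0.
  by rewrite rk_closure.
by rewrite (sum_inverseC (flat_muP (M := M))) // eq_sym (negPf nG) mul0r.
Qed.
(* t^n p(t^-1), for p of degree at most n. *)
Definition recip (n : nat) (p : {poly int}) : {poly int} :=
  \poly_(i < n.+1) p`_(n - i).

Lemma coef_recip n p i : (recip n p)`_i = if (i <= n)%N then p`_(n - i) else 0.
Proof. by rewrite coef_poly ltnS. Qed.

Lemma size_recip n (p : {poly int}) : (size (recip n p) <= n.+1)%N.
Proof. exact: size_poly. Qed.

Lemma recip0 n : recip n 0 = 0.
Proof. by apply/polyP => i; rewrite coef_recip !coef0 if_same. Qed.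

Lemma recipD n p q : recip n (p + q) = recip n p + recip n q.
Proof.
by apply/polyP => i; rewrite !(coef_recip, coefD); case: ifP; rewrite ?addr0.
Qed.

Lemma recipZ n c p : recip n (c *: p) = c *: recip n p.
Proof.
by apply/polyP => i; rewrite !(coef_recip, coefZ); case: ifP; rewrite ?mulr0.
Qed.

Lemma recip_sum n (I : Type) (r : seq I) (P : pred I) (F : I -> {poly int}) :
  recip n (\sum_(i <- r | P i) F i) = \sum_(i <- r | P i) recip n (F i).
Proof. exact: (big_morph _ (recipD n) (recip0 n)). Qed.

Lemma recipK n (p : {poly int}) : (size p <= n.+1)%N -> recip n (recip n p) = p.
Proof.
move=> sp; apply/polyP => i; rewrite !coef_recip; case: leqP => h.
  by rewrite leq_subr subKn.
by rewrite nth_default // (leq_trans sp).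
Qed.

Lemma recipXn n m : (m <= n)%N -> recip n 'X^m = 'X^(n - m).
Proof.
move=> le; apply/polyP => i; rewrite coef_recip !coefXn.
case: leqP => h; first by congr ((nat_of_bool _)%:R); lia.
by case: eqP => // e; lia.
Qed.

Lemma recip1 n : recip n 1 = 'X^n.
Proof. by rewrite -(expr0 'X) recipXn // subn0. Qed.

Lemma recip_sign n k p : recip n ((-1) ^+ k * p) = (-1) ^+ k * recip n p.
Proof.
have e q : (-1) ^+ k * q = (-1) ^+ k *: q :> {poly int}.
  by rewrite -mul_polyC rmorphXn rmorphN1.
by rewrite !e recipZ.
Qed.

Lemma recipM m n (p q : {poly int}) : (size p <= m.+1)%N -> (size q <= n.+1)%N ->
  recip (m + n) (p * q) = recip m p * recip n q.
Proof.
move=> sp sq.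
have e k (r : {poly int}) : (size r <= k.+1)%N -> r = \sum_(i < k.+1) r`_i *: 'X^i.
  move=> sr; rewrite -poly_def; apply/polyP => i; rewrite coef_poly.
  by case: ltnP => // h; rewrite nth_default // (leq_trans sr).
rewrite {1}(e _ _ sp) {1}(e _ _ sq) {2}(e _ _ sp) {2}(e _ _ sq).
rewrite big_distrlr !recip_sum big_distrlr; apply: eq_bigr => i _ /=.
rewrite recip_sum; apply: eq_bigr => j _.
have li := ltn_ord i; have lj := ltn_ord j.
rewrite -scalerAl -scalerAr !recipZ -scalerAl -scalerAr; congr (_ *: (_ *: _)).
rewrite -exprD !recipXn; [|lia..].
by rewrite -exprD; congr ('X^_); lia.
Qed.

Lemma size_charpoly (T : finType) (M : matroid T) :
  (size (charpoly M) <= (rank M).+1)%N.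
Proof.
apply: (leq_trans (size_sum _ _ _)); apply/bigmax_leqP => A _.
rewrite -signr_odd mulr_sign.
by case: ifP; rewrite ?size_polyN size_polyXn ltnS leq_subr.
Qed.

Lemma recip_charpoly_localization (T : finType) (M : matroid T) (F : {set T}) :
  F \subset ground M ->
  recip (rk M F) (charpoly (localization M F)) =
  \sum_(A in powerset F) (-1) ^+ #|A| * 'X^(rk M A).
Proof.
move=> sF; rewrite /charpoly recip_sum /ground /= (setIidPr sF).
apply: eq_bigr => A; rewrite inE => sA.
rewrite recip_sign rank_localization rk_localization (setIidPl sA).
have := rk_sub M sA => le; rewrite recipXn ?leq_subr //.
by congr (_ * 'X^_); lia.
Qed.

Lemma charpoly_kernel (T : finType) (M : matroid T) :
  \sum_(F in flats M) recip (rk M F) (charpoly (localization M F)) *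
     charpoly (contraction M F) = (ground M == set0)%:R.
Proof.
transitivity (\sum_(A in powerset (ground M))
    (-1) ^+ #|A| * 'X^(rank M) : {poly int}); last first.
  rewrite -mulr_suml sum_sign_powerset.
  have [E0|_] := eqVneq (ground M) set0; last by rewrite mul0r.
  by rewrite /rank E0 rk0 mul1r.
transitivity (\sum_(A in powerset (ground M)) \sum_(F in flats M | A \subset F)
    (-1) ^+ #|A| * 'X^(rk M A) * charpoly (contraction M F)); last first.
  apply: eq_bigr => A; rewrite inE => sA.
  rewrite -mulr_sumr sum_charpoly_contraction // -mulrA -exprD.
  by rewrite subnKC // rk_le_rank.
under [RHS]eq_bigr do rewrite big_mkcondr /=.
rewrite exchange_big /=; apply: eq_bigr => F hF.
rewrite recip_charpoly_localization ?flat_sub // mulr_suml.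
rewrite -big_mkcondr /=; apply: eq_bigl => A; rewrite !inE.
by case: (boolP (A \subset F)) => [sA|]; rewrite ?andbF //
  (subset_trans sA) ?flat_sub.
Qed.

Lemma charpoly_loop (T : finType) (M : matroid T) x :
  x \in ground M -> rk M [set x] = 0%N -> charpoly M = 0.
Proof.
move=> xE rx; rewrite /charpoly (bigID (fun A : {set T} => x \in A)) /=.
rewrite (reindex_onto (fun A => x |: A) (fun A => A :\ x)) /=; last first.
  by move=> A /andP[_ xA]; rewrite setD1K.
apply/eqP; rewrite addr_eq0 -sumrN; apply/eqP; apply: eq_big => A.
  rewrite !inE eqxx orTb andbT subUset sub1set xE /=.
  congr (_ && _); apply/eqP/idP => [<-|xA]; first by rewrite !inE eqxx.
  by rewrite setU1K.
rewrite !inE => /andP[_ /eqP e].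
have xA : x \notin A by rewrite -e !inE eqxx.
rewrite cardsU1 xA add1n exprS mulN1r mulNr; congr (- (_ * 'X^(_ - _))).
apply/eqP; rewrite eqn_leq [X in _ && X]rk_sub ?subsetU1 // andbT.
by have := rk_submod M [set x] A; rewrite rx; lia.
Qed.

Lemma charpoly_loop0 (T : finType) (M : matroid T) (F : {set T}) :
  set0 \notin flats M -> F \in flats M -> charpoly (localization M F) = 0.
Proof.
rewrite inE sub0set /= => /forall_inPn[x]; rewrite setD0 setU0 rk0 -eqn0Ngt.
move=> xE /eqP rx /flatP[sF hF]; have xF : x \in F.
  apply: hF => //; apply/eqP.
  rewrite eqn_leq [X in _ && X]rk_sub ?subsetU1 // andbT.
  by have := rk_submod M [set x] F; rewrite rx; lia.
apply: (@charpoly_loop _ _ x); first by rewrite inE xE.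
by rewrite rk_localization (setIidPl _) // sub1set.
Qed.

Lemma charpoly_localization0 (T : finType) (M : matroid T) :
  charpoly (localization M set0) = 1.
Proof.
rewrite /charpoly rank_localization /ground /= setI0.
rewrite (big_pred1 set0) => [|A]; last by rewrite !inE subset0.
by rewrite cards0 rk0 sub0n mulr1.
Qed.

Lemma sum_flats_contraction (T : finType) (M : matroid T) (F : {set T})
    (H : {set T} -> {poly int}) :
  F \in flats M ->
  \sum_(G in flats (contraction M F)) H G =
  \sum_(G in flats M | F \subset G) H (G :\: F).
Proof.
move=> hF; rewrite flats_contraction // big_imset /=.
  by apply: eq_bigl => G; rewrite inE.
move=> G1 G2; rewrite !inE => /andP[_ s1] /andP[_ s2] e.
by rewrite -(setDUsub s1) e setDUsub.
Qed.

(* The defining properties of M |-> P_M. The minors of M are matroids over the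
   same T, so the assignment is taken over all matroids in a fixed T. For
   rank M > 0 the degree condition reads 2 deg(P_M) < rank M, with
   deg = (size _).-1 for nonzero polynomials. *)
Definition is_KL (T : finType) (P : {ffun matroid T -> {poly int}}) : bool :=
  [forall M : matroid T,
    [&& (rank M == 0)%N ==> (P M == (ground M == set0)%:R),
        (0 < rank M)%N ==> ((size (P M)).-1.*2 < rank M)%N &
        recip (rank M) (P M) ==
          \sum_(F in flats M)
             charpoly (localization M F) * P (contraction M F)]].

Definition KL_sum (T : finType) (P : matroid T -> {poly int}) (M : matroid T) :=
  \sum_(F in flats M | F != set0)
     charpoly (localization M F) * P (contraction M F).

Lemma KL_sumE (T : finType) (P : matroid T -> {poly int}) (M : matroid T) :
  \sum_(F in flats M) charpoly (localization M F) * P (contraction M F) =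
  (set0 \in flats M)%:R * P M + KL_sum P M.
Proof.
rewrite (bigID (fun F => F == set0)) /=; congr (_ + _).
have [h0|h0] := boolP (set0 \in flats M).
  rewrite (big_pred1 set0) => [|A]; last first.
    by rewrite /= andbC; case: eqVneq => [->|//]; rewrite h0.
  by rewrite charpoly_localization0 contraction0.
rewrite mul0r big1 // => A /andP[hA /eqP A0].
by rewrite A0 (negPf h0) in hA.
Qed.

Lemma card_contraction (T : finType) (M : matroid T) (F : {set T}) :
  F \in flats M -> F != set0 ->
  (#|ground (contraction M F)| < #|ground M|)%N.
Proof.
move=> hF F0; have := cardsD (ground M) F; rewrite /ground /= => ->.
have := flat_sub hF => sF; rewrite (setIidPr sF).
have := subset_leq_card sF; move: F0; rewrite -card_gt0 /ground; lia.
Qed.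

Lemma KL_sum_ext (T : finType) (P Q : matroid T -> {poly int}) (M : matroid T) :
  (forall N : matroid T, (#|ground N| < #|ground M|)%N -> P N = Q N) ->
  KL_sum P M = KL_sum Q M.
Proof.
move=> e; apply: eq_bigr => F /andP[hF F0].
by rewrite e // card_contraction.
Qed.

Lemma deg_half_nth (p : {poly int}) (r i : nat) :
  ((size p).-1.*2 < r)%N -> (r <= i.*2)%N -> p`_i = 0.
Proof.
by move: (size p) (@nth_default _ 0 p i) => n h ? ?; apply: h; lia.
Qed.

Lemma KL_unique (T : finType) (P Q : {ffun matroid T -> {poly int}}) :
  is_KL P -> is_KL Q -> P = Q.
Proof.
move=> /forallP hP /forallP hQ; apply/ffunP => M.
have [n] := ubnP #|ground M|; elim: n M => // n IH M le.
case/and3P: (hP M); case/and3P: (hQ M).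
case: (posnP (rank M)) => [_|r0] /=.
  by move=> /eqP -> _ _ /eqP ->.
rewrite !KL_sumE => _ dQ /eqP eQ _ dP /eqP eP.
have eS : KL_sum P M = KL_sum Q M.
  by apply: KL_sum_ext => N lt; apply: IH; apply: leq_trans lt _.
set r := rank M in r0 dP dQ eP eQ.
apply/polyP => i; case: (ltnP i.*2 r) => hi; last first.
  by rewrite (deg_half_nth dP) ?(deg_half_nth dQ).
have := congr1 (fun p : {poly int} => p`_(r - i)) eP.
have := congr1 (fun p : {poly int} => p`_(r - i)) eQ.
rewrite !coef_recip leq_subr subKn; last by lia.
move=> -> ->; rewrite eS !coefD -!polyC_natr !coefCM.
by rewrite (deg_half_nth dP) ?(deg_half_nth dQ) //; lia.
Qed.

(* Only used to prove KL_exists. *)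
Fixpoint KL_rec (T : finType) (n : nat) (M : matroid T) : {poly int} :=
  if n isn't n'.+1 then 0 else
  if rank M == 0%N then (ground M == set0)%:R else
  \poly_(i < uphalf (rank M)) (KL_sum (KL_rec n') M)`_(rank M - i).

Lemma KL_rec_fuel (T : finType) (n m : nat) (M : matroid T) :
  (#|ground M| < n)%N -> (#|ground M| < m)%N -> KL_rec n M = KL_rec m M.
Proof.
elim: n m M => // n IH [|m] M //= ln lm; case: ifP => // _.
rewrite (@KL_sum_ext _ (KL_rec n) (KL_rec m)) // => N lt.
by apply: IH; apply: leq_trans lt _.
Qed.

Lemma size_KL (T : finType) (P : matroid T -> {poly int}) (M : matroid T) :
  (rank M == 0%N -> P M = (ground M == set0)%:R) ->
  (0 < rank M -> (size (P M)).-1.*2 < rank M)%N ->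
  (size (P M) <= (rank M).+1)%N.
Proof.
have [->|r0] := posnP (rank M) => [/(_ isT) -> _|_ /(_ isT)].
  by rewrite -polyC_natr size_polyC; case: (_ != _).
by move: (size _) (rank M) => a b; lia.
Qed.

Lemma recip_contraction (T : finType) (P : matroid T -> {poly int})
    (M : matroid T) (F : {set T}) :
  F \in flats M ->
  recip (rank (contraction M F)) (P (contraction M F)) =
    \sum_(G in flats (contraction M F))
       charpoly (localization (contraction M F) G) *
       P (contraction (contraction M F) G) ->
  recip (rank (contraction M F)) (P (contraction M F)) =
    \sum_(G in flats M | F \subset G)
       charpoly (contraction (localization M G) F) * P (contraction M G).
Proof.
move=> hF ->; rewrite sum_flats_contraction //.
apply: eq_bigr => G /andP[hG sFG].
by rewrite contraction_localization // contraction_contraction.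
Qed.

Lemma flats_localization_sub (T : finType) (M : matroid T) (F G : {set T}) :
  G \in flats M ->
  (F \in flats (localization M G)) = (F \in flats M) && (F \subset G).
Proof. by move=> hG; rewrite flats_localization // [LHS]inE. Qed.

Lemma recip_KL_sum (T : finType) (P : matroid T -> {poly int}) (M : matroid T) :
  (forall F, F \in flats M -> F != set0 ->
     (size (P (contraction M F)) <= (rank (contraction M F)).+1)%N /\
     recip (rank (contraction M F)) (P (contraction M F)) =
       \sum_(G in flats (contraction M F))
          charpoly (localization (contraction M F) G) *
          P (contraction (contraction M F) G)) ->
  set0 \in flats M ->
  (size (KL_sum P M) <= (rank M).+1)%N /\
  recip (rank M) (KL_sum P M) = - KL_sum P M.
Proof.
move=> hP h0; split.
  apply: (leq_trans (size_sum _ _ _)); apply/bigmax_leqP => F /andP[hF F0].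
  have [sP _] := hP F hF F0; have sc := size_charpoly (localization M F).
  apply: (leq_trans (size_polyMleq _ _)).
  have := rank_contraction M F; rewrite rank_localization in sc.
  move: (size _) (size _) (rank _) (rank _) sP sc => a b c d; lia.
rewrite /KL_sum recip_sum.
transitivity (\sum_(F in flats M | F != set0)
    \sum_(G in flats M | F \subset G)
       recip (rk M F) (charpoly (localization M F)) *
       charpoly (contraction (localization M G) F) * P (contraction M G)).
  apply: eq_bigr => F /andP[hF F0]; have [sP rP] := hP F hF F0.
  rewrite -{1}(rank_contraction M F) addnC recipM //; last first.
    by rewrite -rank_localization size_charpoly.
  rewrite (recip_contraction hF rP) mulr_sumr.
  by apply: eq_bigr => G _; rewrite mulrA.
rewrite (exchange_big_dep (fun G => (G \in flats M) && (G != set0))) /=.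
  rewrite -sumrN; apply: eq_bigr => G /andP[hG G0].
  rewrite -mulr_suml -mulNr; congr (_ * _).
  have := charpoly_kernel (localization M G).
  have -> : ground (localization M G) = G.
    by rewrite /ground /=; apply/setIidPr/flat_sub.
  rewrite (negPf G0) (bigD1 set0) /=; last first.
    by rewrite flats_localization_sub // h0 sub0set.
  rewrite rk0 localization_localization ?sub0set // charpoly_localization0.
  rewrite recip1 expr0 mul1r contraction0 => /eqP.
  rewrite addrC addr_eq0 => /eqP <-.
  apply: eq_big => [F|F /andP[_ /andP[_ sF]]].
    by rewrite flats_localization_sub // hG /=; do !case: (_ \in _);
       rewrite ?andbT ?andbF //= andbC.
  by rewrite localization_localization // rk_localization (setIidPl sF).
move=> F G /andP[hF F0] /andP[-> sFG] /=.
by apply: contraNneq F0 => G0; rewrite -subset0 -G0.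
Qed.

Lemma KL_exists (T : finType) :
  exists P : {ffun matroid T -> {poly int}}, is_KL P.
Proof.
pose K (M : matroid T) := KL_rec #|ground M|.+1 M.
have KE M : K M = if rank M == 0%N then (ground M == set0)%:R else
    \poly_(i < uphalf (rank M)) (KL_sum K M)`_(rank M - i).
  rewrite /K /=; case: ifP => // _.
  suff -> : KL_sum (KL_rec #|ground M|) M = KL_sum K M by [].
  by apply: KL_sum_ext => N lt; apply: KL_rec_fuel.
have K0 M : rank M == 0%N -> K M = (ground M == set0)%:R.
  by rewrite KE => ->.
have Kd M : (0 < rank M -> (size (K M)).-1.*2 < rank M)%N.
  move=> r0; rewrite KE eqn0Ngt r0 /=.
  set p := (\poly_(i < _) _); have : (size p <= uphalf (rank M))%N.
    exact: size_poly.
  by move: (size p) (rank M) r0 => a b; lia.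
have Ks M : (size (K M) <= (rank M).+1)%N by apply: size_KL => [/K0|/Kd].
exists [ffun M => K M]; apply/forallP => M; rewrite !ffunE.
apply/and3P; split; first by apply/implyP => /K0 ->.
  by apply/implyP => /Kd.
apply/eqP; under eq_bigr do rewrite ffunE.
have [n] := ubnP #|ground M|; elim: n M => // n IH M le.
have {}IH (F : {set T}) : F \in flats M -> F != set0 ->
     (size (K (contraction M F)) <= (rank (contraction M F)).+1)%N /\
     recip (rank (contraction M F)) (K (contraction M F)) =
       \sum_(G in flats (contraction M F))
          charpoly (localization (contraction M F) G) *
          K (contraction (contraction M F) G).
  move=> hF F0; split=> //; apply: IH.
  by apply: leq_trans (card_contraction hF F0) _.
rewrite KL_sumE; have [h0|h0] := boolP (set0 \in flats M); last first.
  have S0 : KL_sum K M = 0.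
    by apply: big1 => F /andP[hF _]; rewrite charpoly_loop0 // mul0r.
  rewrite S0 mul0r addr0 KE S0; case: ifP => [_|_].
    have [E0|_] := eqVneq (ground M) set0; last exact: recip0.
    by have := ground_flat M; rewrite E0 (negPf h0).
  rewrite (_ : \poly_(i < _) _ = 0) ?recip0 //.
  by apply/polyP => i; rewrite coef_poly !coef0 if_same.
have [sS rS] := recip_KL_sum IH h0; rewrite mul1r.
have [r0|r0] := posnP (rank M).
  have E0 : ground M = set0.
    apply/eqP; rewrite -subset0; case/flatP: h0 => _ h; apply/subsetP => x xE.
    apply: h => //; apply/eqP; rewrite rk0 -leqn0 -r0; exact: rk_le_rank.
  rewrite K0 ?r0 // E0 eqxx recip1 /KL_sum big_pred0 ?addr0 // => F.
  apply/negP => /andP[/flat_sub]; rewrite E0 subset0 => /eqP ->.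
  by rewrite eqxx.
have {}KE : K M = \poly_(i < uphalf (rank M)) (KL_sum K M)`_(rank M - i).
  by rewrite KE eqn0Ngt r0.
move: (KL_sum K M) (rank M) r0 sS rS KE => S r r0 sS rS ->.
have eS i : (i <= r)%N -> S`_(r - i) = - S`_i.
  by move=> ir; rewrite -coefN -rS coef_recip ir.
apply/polyP => i; rewrite coef_recip coefD !coef_poly.
case: (leqP i r) => ir; last first.
  rewrite (nth_default _ (leq_trans sS ir)) addr0.
  by case: ltnP => //; lia.
have [lt|gt|eq] := ltngtP i.*2 r.
- rewrite ifF ?ifT; try by lia.
  by rewrite eS // addNr.
- rewrite ifT ?ifF; try by lia.
  by rewrite subKn // add0r.
rewrite !ifF; try by lia.
have := eS i ir; rewrite -eq -addnn addnK add0r => e.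
by move: e; move: (S`_i) => z; lia.
Qed.

(* The assignment characterised by is_KL, cf. KL_exists and KL_unique. *)
Definition KLpoly (T : finType) (M : matroid T) : {poly int} :=
  xchoose (KL_exists T) M.

Definition Zpoly (T : finType) (M : matroid T) : {poly int} :=
  \sum_(F in flats M) 'X^(rk M F) * KLpoly (contraction M F).

Lemma Zpoly_palindromic (T : finType) (M : matroid T) :
  recip (rank M) (Zpoly M) = Zpoly M.
Proof.
have /forallP hK := xchooseP (KL_exists T).
have Ks (N : matroid T) : (size (KLpoly N) <= (rank N).+1)%N.
  have /and3P[/implyP h1 /implyP h2 _] := hK N.
  by apply: size_KL => [/h1/eqP|/h2].
rewrite {1}/Zpoly recip_sum.
transitivity (\sum_(F in flats M) \sum_(G in flats M | F \subset G)
   charpoly (contraction (localization M G) F) * KLpoly (contraction M G)).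
  apply: eq_bigr => F hF.
  rewrite -(rank_contraction M F) addnC recipM ?size_polyXn //.
  rewrite recipXn // subnn expr0 mul1r (recip_contraction hF) //.
  by have /and3P[_ _ /eqP] := hK (contraction M F).
rewrite (exchange_big_dep (mem (flats M))) /=; last by move=> ? ? _ /andP[].
apply: eq_bigr => G hG; rewrite -mulr_suml; congr (_ * _).
have := sum_charpoly_contraction (sub0set (ground (localization M G))).
rewrite rk0 subn0 rank_localization => <-; apply: eq_bigl => F.
by rewrite flats_localization_sub // hG sub0set andbT.
Qed.

Lemma size_Zpoly (T : finType) (M : matroid T) :
  (size (Zpoly M) <= (rank M).+1)%N.
Proof. by rewrite -Zpoly_palindromic size_recip. Qed.

Definition is_gamma (r : nat) (Z g : {poly int}) : bool :=
  (size g <= r./2.+1)%N &&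
  (Z == \sum_(i < r./2.+1) g`_i *: ('X^i * (1 + 'X) ^+ (r - i.*2))).

Lemma gamma_unique r Z g1 g2 : is_gamma r Z g1 -> is_gamma r Z g2 -> g1 = g2.
Proof.
have inj m (d : nat -> int) (e : nat -> nat) :
    \sum_(i < m) d i *: ('X^i * (1 + 'X) ^+ e i) = 0 ->
    forall i, (i < m)%N -> d i = 0.
  elim: m d e => // m IH d e; rewrite big_ord_recl expr0 mul1r => h.
  have e1 : \sum_(i < m) d (bump 0 i) *:
      ('X^(bump 0 i) * (1 + 'X) ^+ e (bump 0 i)) =
    'X * \sum_(i < m) d i.+1 *: ('X^i * (1 + 'X) ^+ e i.+1).
    rewrite mulr_sumr; apply: eq_bigr => i _.
    by rewrite /bump /= add1n exprS -scalerAr mulrA.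
  rewrite e1 in h.
  have d0 : d 0%N = 0.
    have := congr1 (fun p : {poly int} => p.[0]) h.
    by rewrite !hornerE expr1n mulr1.
  move: h; rewrite d0 scale0r add0r => /eqP; rewrite mulf_eq0 polyX_eq0 /=.
  by move=> /eqP/(IH (d \o succn) (e \o succn)) h [|i] //; apply: h.
move=> /andP[s1 /eqP e1] /andP[s2 /eqP e2]; apply/polyP => i.
case: (ltnP i r./2.+1) => hi; last by rewrite !nth_default // (leq_trans _ hi).
apply/eqP; rewrite -subr_eq0; apply/eqP; move: i hi.
apply: (inj _ (fun i => g1`_i - g2`_i) (fun i => (r - i.*2)%N)).
under eq_bigr do rewrite scalerBl.
by rewrite sumrB -e1 -e2 subrr.
Qed.

Lemma recip_1X n : recip n ((1 + 'X) ^+ n) = (1 + 'X) ^+ n.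
Proof.
have s1 : size (1 + 'X : {poly int}) = 2 by rewrite addrC size_XaddC.
elim: n => [|n IH]; first by rewrite !expr0 recip1 expr0.
rewrite !exprS -add1n recipM ?s1 // ?IH.
  by rewrite recipD recip1 expr1 -['X]expr1 recipXn // subnn addrC.
by apply: (leq_trans (size_poly_exp_leq _ _)); rewrite s1 /= mul1n.
Qed.

Lemma gamma_exists r (Z : {poly int}) :
  recip r Z = Z -> exists g, is_gamma r Z g.
Proof.
have [n] := ubnP r; elim: n r Z => // n IH r Z ler rZ.
have sZ : (size Z <= r.+1)%N by rewrite -rZ size_recip.
have [r1|r2] := leqP r 1.
  exists (Z`_0)%:P; rewrite /is_gamma; have -> : r./2 = 0%N by lia.
  rewrite size_polyC_leq1 big_ord1 coefC /= mul1r subn0; apply/eqP.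
  apply/polyP => i; rewrite coefZ.
  have := congr1 (fun p : {poly int} => p`_i) rZ; rewrite coef_recip.
  case: r r1 sZ {ler rZ} => [|[|//]] _ sZ.
    rewrite expr0 coef1; case: i => [|i] _; rewrite ?mulr1 // mulr0.
    by rewrite nth_default // (leq_trans sZ).
  rewrite expr1 coefD coef1 coefX; case: i => [|[|i]] e.
  - by rewrite addr0 mulr1.
  - by rewrite add0r mulr1 -e.
  by rewrite addr0 mulr0 nth_default // (leq_trans sZ).
case: r r2 ler rZ sZ => [|[|r]] // _ ler rZ sZ.
pose c := Z`_0; pose Z1 := Z - c *: (1 + 'X) ^+ r.+2.
have rZ1 : recip r.+2 Z1 = Z1.
  by rewrite /Z1 -scaleNr recipD recipZ recip_1X rZ.
have Z10 : Z1`_0 = 0.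
  have h1 : (1 + 'X : {poly int}).[0] = 1 by rewrite !hornerE.
  rewrite coefB coefZ -[((1 + 'X) ^+ _)`_0]horner_coef0 horner_exp h1.
  by rewrite expr1n mulr1 subrr.
pose W := \poly_(i < r.+1) Z1`_i.+1.
have Z1W : Z1 = 'X * W.
  apply/polyP => -[|i]; rewrite coefXM //= coef_poly; case: ltnP => // hi.
  rewrite -rZ1 coef_recip; case: leqP => // h2.
  by have -> : (r.+2 - i.+1 = 0)%N by lia.
have rW : recip r W = W.
  apply/polyP => i; rewrite coef_recip !coef_poly !ltnS leq_subr.
  case: (leqP i r) => // hi; rewrite -[in RHS]rZ1 coef_recip ifT; last by lia.
  by congr (Z1`_ _); lia.
have [|g /andP[sg /eqP eg]] := IH r W _ rW; first by lia.
exists (c%:P + g * 'X); apply/andP; split.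
  apply: (leq_trans (size_polyD _ _)); rewrite geq_max.
  rewrite (leq_trans (size_polyC_leq1 _)) //=.
  by apply: (leq_trans (size_polyMleq _ _)); rewrite size_polyX addn2 /= ltnS.
have -> : r.+2./2.+1 = r./2.+2 by [].
rewrite big_ord_recl /= expr0 mul1r subn0 coefD coefC coefMX /= addr0.
rewrite addrC -subr_eq -/Z1 Z1W eg mulr_sumr; apply/eqP.
apply: eq_bigr => i _; rewrite /bump /= add1n coefD coefC coefMX /= add0r.
by rewrite -scalerAr mulrA -exprS.
Qed.

Lemma gamma_Zpoly_exists (T : finType) (M : matroid T) :
  exists g, is_gamma (rank M) (Zpoly M) g.
Proof. exact/gamma_exists/Zpoly_palindromic. Qed.

(* The polynomial characterised by is_gamma, cf. gamma_unique. *)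
Definition gammapoly (T : finType) (M : matroid T) : {poly int} :=
  xchoose (gamma_Zpoly_exists M).

(* Main.v *)
Require Import Defs.
From mathcomp Require Import all_boot all_order all_algebra.
From mathcomp Require Import zify ring.

Set Implicit Arguments.
Unset Strict Implicit.
Unset Printing Implicit Defensive.

Import GRing.Theory.

(* Let R be the relaxation of M at H, with k the rank and h = |H|. The subsets
   of H with fewer than k elements are independent, so R and M have the same
   flats, except that the flat H of M is replaced by all (k - 1)-subsets of H;
   for a flat F not contained in H the contractions of R and M at F agree, and
   for F contained in H with |F| < k the contraction of R at F is the relaxation
   of that of M at H \ F. Hence Z_R - Z_M equals (P_R - P_M) + S, where by
   induction on the rank S depends only on k and h. As this sum is palindromic
   and P_R - P_M has degree less than k/2, S determines P_R - P_M, and with it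
   Z_R - Z_M. The gamma-polynomial is additive in Z. *)

(** * Ranks, independence and stressed hyperplanes *)

Lemma sub_card_between (T : finType) (A B : {set T}) (n : nat) :
  A \subset B -> #|A| <= n <= #|B| ->
  exists S : {set T}, [/\ A \subset S, S \subset B & #|S| = n].
Proof.
move=> sAB; elim: n => [|n IH] /andP[leA leB].
  by exists A; split=> //; apply/eqP; rewrite -leqn0.
move: leA; rewrite leq_eqVlt => /orP[/eqP eA|ltA].
  by exists A.
have [|S [sAS sSB cS]] := IH; first by rewrite -ltnS ltA ltnW.
have /subsetPn[x xB xS] : ~~ (B \subset S).
  by apply/negP => /subset_leq_card; rewrite cS leqNgt leB.
exists (x |: S); split; first by rewrite subsetU // sAS orbT.
  by rewrite subUset sub1set xB.
by rewrite cardsU1 xS cS.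
Qed.

Lemma rk_card (T : finType) (M : matroid T) (A : {set T}) : rk M A <= #|A|.
Proof. by have [B _ <-] := rk_ex M A; rewrite subset_leq_card ?subsetIl. Qed.

Lemma indepE (T : finType) (M : matroid T) (A : {set T}) :
  indep M A = (rk M A == #|A|).
Proof.
apply/idP/eqP => [/rk_indep //|rA]; have [B hB eB] := rk_ex M A.
apply/exists_inP; exists B => //; apply/setIidPl/eqP.
by rewrite eqEcard subsetIl eB rA leqnn.
Qed.

(** If [x] did not raise the rank of [F], submodularity for [x |: F] and [H] would force [x] into
    the closed set [H]. *)
Lemma rk_lt_out_flat (T : finType) (M : matroid T) (F H : {set T}) x :
  H \in flats M -> F \subset H -> x \in ground M -> x \notin H ->
  rk M F < rk M (x |: F).
Proof.
move=> /flatP[_ fH] sFH xE xH; have sxF := rk_sub M (subsetU1 x F).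
have [//|le] := ltnP; have e : rk M (x |: F) = rk M F by lia.
suff : x \in H by rewrite (negPf xH).
apply: fH => //; have := rk_submod M (x |: F) H.
have := rk_sub M (subsetU1 x H).
have : rk M F <= rk M ((x |: F) :&: H).
  by rewrite rk_sub // subsetI subsetUr.
rewrite -setUA (setUidPr sFH) e; lia.
Qed.

Lemma flat_full_rank (T : finType) (M : matroid T) (F : {set T}) :
  F \in flats M -> rk M F = rank M -> F = ground M.
Proof.
move=> /flatP[sF fF] rF; apply/eqP; rewrite eqEsubset sF.
apply/subsetP => x xE; apply: fF => //.
have := rk_le_rank M (x |: F); have := rk_sub M (subsetU1 x F); lia.
Qed.

(** The rank form is the one that passes to contractions. A subset of [H] with fewer than k elements
    lies properly inside a k-subset, which is a circuit, as soon as [H] has one. *)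
Lemma stressedP (T : finType) (M : matroid T) (H : {set T}) :
  reflect (hyperplane M H /\
           forall A : {set T}, A \subset H -> #|A| < rank M -> rk M A = #|A|)
          (stressed_hyperplane M H).
Proof.
apply: (iffP andP) => -[hH st]; split=> //.
  move=> A sAH ltA; have /andP[_ /eqP rH] := hH.
  have [leH|ltH] := leqP (rank M) #|H|.
    have [|S [sAS sSH cS]] := sub_card_between (n := rank M) sAH.
      by rewrite ltnW.
    have /subsetPn[x xS xA] : ~~ (S \subset A).
      by apply/negP => /subset_leq_card; rewrite cS leqNgt ltA.
    have /implyP/(_ _)/circuitD1/(_ xS) := forallP st S.
    rewrite sSH cS eqxx => /(_ isT)/exists_inP[B hB sB].
    apply/rk_indep/exists_inP; exists B => //; apply: subset_trans sB.
    by rewrite subsetD1 sAS.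
  (* Here [H] has no k-subset, but its rank k - 1 is at least its cardinality, so [H] is
     independent. *)
  have eH : rk M H = #|H| by have := rk_card M H; lia.
  move/eqP: eH; rewrite -indepE => /exists_inP[B hB sB].
  by apply/rk_indep/exists_inP; exists B; rewrite // (subset_trans sAH).
have /andP[/flat_sub sH /eqP rH] := hH.
apply/forallP => S; apply/implyP => /andP[sS /eqP cS].
apply/minsetP; split=> [|D /andP[_ nD] sD].
  rewrite (subset_trans sS sH) /= indepE cS; have := rk_sub M sS; lia.
apply/eqP; rewrite eqEcard sD leqNgt cS; apply: contra nD => ltD.
by rewrite indepE st ?eqxx ?(subset_trans sD).
Qed.

(** * Ranks, flats and contractions of the relaxation *)

Section StressedFacts.

Variables (T : finType) (M : matroid T) (H : {set T}).
Hypothesis sH : stressed_hyperplane M H.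

Let R := relaxation sH.

Lemma stressed_flat : H \in flats M.
Proof. by case/andP: sH => /andP[]. Qed.

Lemma stressed_rk : (rk M H).+1 = rank M.
Proof. by case/andP: sH => /andP[_ /eqP]. Qed.

Lemma rk_stressed_sub (A : {set T}) :
  A \subset H -> #|A| < rank M -> rk M A = #|A|.
Proof. by case/stressedP: sH => _; apply. Qed.

Lemma leq_rk_relaxation (A : {set T}) : rk M A <= rk R A.
Proof.
by have [B hB <-] := rk_ex M A; rewrite rk_ge // inE hB.
Qed.

Lemma rank_relaxation : rank R = rank M.
Proof.
have [B hB] := bases_ex M; rewrite (rank_bases hB).
by apply: rank_bases; rewrite inE hB.
Qed.

(** All k-subsets of [H] become bases, so [R] is uniform on [H]. *)
Lemma rk_relaxation_sub (A : {set T}) :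
  A \subset H -> rk R A = minn #|A| (rank M).
Proof.
move=> sA; apply/eqP; rewrite eqn_leq leq_min rk_card -rank_relaxation.
rewrite rk_le_rank rank_relaxation /=.
have [leA|ltA] := leqP (rank M) #|A|; last first.
  by rewrite -rk_stressed_sub // leq_rk_relaxation.
have [|S [_ sSA cS]] := sub_card_between (n := rank M) (sub0set A).
  by rewrite cards0.
rewrite -cS -(setIidPr sSA) rk_ge // !inE (subset_trans sSA sA) cS eqxx.
by rewrite orbT.
Qed.

(** Only a new basis [B] inside [H] could raise the rank. If [A] misses part of [B], then [A :&: B]
    is already independent in [M]; otherwise swapping an element of [B] for a point of [A] outside
    [H] gives a basis of [M] inside [A]. *)
Lemma rk_relaxation_out (A : {set T}) :
  ~~ (ground M :&: A \subset H) -> rk R A = rk M A.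
Proof.
case/subsetPn => e; rewrite inE => /andP[eE eA] eH.
apply/eqP; rewrite eqn_leq leq_rk_relaxation andbT.
have [B + <-] := rk_ex R A; rewrite !inE => /orP[|/andP[sBH /eqP cB]].
  exact: rk_ge.
have [sBA|nBA] := boolP (B \subset A); last first.
  rewrite -(rk_stressed_sub _ (_ : #|A :&: B| < _)).
  - by rewrite rk_sub ?subsetIl.
  - by rewrite (subset_trans (subsetIr _ _)).
  rewrite -cB proper_card // properE subsetIr /=.
  by apply: contra nBA => /subset_trans; apply; apply: subsetIl.
have /card_gt0P[x xB] : 0 < #|B| by rewrite cB -stressed_rk.
have hB : e |: B :\ x \in bases M.
  by apply: (stressed_basis sH) => //; rewrite inE eH.
rewrite (setIidPr sBA) cB (rank_bases hB) -(setIidPr (_ : _ |: _ \subset A)).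
  exact: rk_ge.
by rewrite subUset sub1set eA (subset_trans (subD1set _ _)).
Qed.

Lemma flats_relaxation_out (F : {set T}) :
  ~~ (F \subset H) -> (F \in flats R) = (F \in flats M).
Proof.
move=> nF.
have out (A : {set T}) : F \subset ground M -> F \subset A -> rk R A = rk M A.
  move=> sF sFA; apply: rk_relaxation_out; apply: contra nF => s.
  by apply: subset_trans s; rewrite subsetI sF.
apply/flatP/flatP => -[sF fF]; split=> // x xE; have := fF x xE.
  by rewrite !out ?subsetU1.
by rewrite !out ?subsetU1.
Qed.

(** Any k - 1 elements of [H] span it, so a proper subset of at least that size is not closed; to a
    smaller set every new point adds rank. *)
Lemma flats_stressed_sub (F : {set T}) :
  F \subset H -> (F \in flats M) = (F == H) || (#|F| < (rank M).-1).
Proof.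
move=> sF; have fH := stressed_flat; have rH := stressed_rk.
have [->|nF] := eqVneq F H; first by rewrite fH.
apply/flatP/idP => [[_ fF]|ltF] /=.
  rewrite ltnNge; apply: contra nF => leF; rewrite eqEsubset sF.
  apply/subsetP => x xH; apply: fF; first exact: (subsetP (flat_sub fH)).
  have sxF : x |: F \subset H by rewrite subUset sub1set xH.
  have [|S [_ sSF cS]] := sub_card_between (n := (rank M).-1) (sub0set F).
    by rewrite cards0.
  have := rk_sub M sSF; rewrite rk_stressed_sub ?(subset_trans sSF) ?cS //;
    last by lia.
  have := rk_sub M sxF; have := rk_sub M (subsetU1 x F); lia.
split=> [|x xE e]; first exact: subset_trans sF (flat_sub fH).
have xH : x \in H.
  by apply/negPn/negP => /(rk_lt_out_flat fH sF xE); rewrite e ltnn.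
apply/negPn/negP => xF; have cF : #|x |: F| = #|F|.+1 by rewrite cardsU1 xF.
move: e; rewrite !rk_stressed_sub ?subUset ?sub1set ?xH ?cF //; lia.
Qed.

Lemma flats_relaxation_sub (F : {set T}) :
  F \subset H -> (F \in flats R) = (#|F| <= (rank M).-1).
Proof.
move=> sF; have fH := stressed_flat; have rH := stressed_rk.
apply/idP/idP => [fF|leF].
  rewrite leqNgt; apply/negP => gtF.
  (* A flat with at least k elements would span [R] and be the whole ground set, yet it lies in [H],
     of rank k - 1 in [M]. *)
  have /(flat_full_rank fF) eF : rk R F = rank R.
    rewrite rk_relaxation_sub // rank_relaxation; lia.
  have := rk_sub M sF; rewrite eF -/(ground M) -/(rank M); lia.
apply/flatP; split=> [|x xE]; first exact: subset_trans sF (flat_sub fH).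
have rF : rk R F = rk M F.
  rewrite rk_relaxation_sub // rk_stressed_sub //; lia.
have [xH|xH] := boolP (x \in H).
  rewrite !rk_relaxation_sub ?subUset ?sub1set ?xH // cardsU1.
  by case: (x \in F) => //= e; exfalso; lia.
have := rk_lt_out_flat fH sF xE xH; rewrite rF.
have := leq_rk_relaxation (x |: F); lia.
Qed.

Lemma contraction_relaxation_out (F : {set T}) :
  F \subset ground M -> ~~ (F \subset H) -> contraction R F = contraction M F.
Proof.
move=> sF nF; apply: matroid_eq => // A; apply/eqP.
rewrite -(eqn_add2r (rk R F)) rk_contraction.
have out (B : {set T}) : F \subset B -> rk R B = rk M B.
  move=> sFB; apply: rk_relaxation_out; apply: contra nF => s.
  by apply: subset_trans s; rewrite subsetI sF.
by rewrite !out ?subsetUr // rk_contraction.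
Qed.

Lemma stressed_contraction (F : {set T}) :
  F \subset H -> #|F| < rank M ->
  stressed_hyperplane (contraction M F) (H :\: F).
Proof.
move=> sF ltF; have rF := rk_stressed_sub sF ltF.
have rC := rank_contraction M F; have rH := stressed_rk.
apply/stressedP; split.
  apply/andP; split; first exact: flats_contraction_sub stressed_flat sF.
  have := rk_contraction M F (H :\: F); rewrite setDUsub //; lia.
move=> A; rewrite subsetD => /andP[sA dA] ltA.
have cU : #|A :|: F| = #|A| + #|F| by apply/eqP; rewrite leq_card_setU.
have := rk_contraction M F A; rewrite [rk M (_ :|: _)]rk_stressed_sub.
- lia.
- by rewrite subUset sA.
- lia.
Qed.

End StressedFacts.

(** On sets reaching outside [H :\: F] both sides have the ranks of the contraction of [M]; inside
    it both are uniform of rank k - |F|. *)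
Lemma contraction_relaxation_sub (T : finType) (M : matroid T) (H F : {set T})
    (sH : stressed_hyperplane M H) (sF : F \subset H) (ltF : #|F| < rank M) :
  contraction (relaxation sH) F = relaxation (stressed_contraction sH sF ltF).
Proof.
set R := relaxation sH; set sC := stressed_contraction _ _ _; have rC := rank_contraction M F.
have rF := rk_stressed_sub sH sF ltF.
have rRF : rk R F = #|F| by rewrite rk_relaxation_sub //; lia.
apply: matroid_eq => // A; pose A' := ground (contraction M F) :&: A.
have [sA|nA] := boolP (A' \subset H :\: F); last first.
  have := rk_contraction R F A; rewrite (rk_relaxation_out sC) //.
  rewrite [rk R (_ :|: _)]rk_relaxation_out.
    by have := rk_contraction M F A; lia.
  apply: contra nA => sU; apply/subsetP => x; rewrite !inE.
  move=> /andP[/andP[-> xE] xA].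
  by apply: (subsetP sU); rewrite !inE xE xA.
rewrite -[rk (relaxation _) A]rk_ground -[rk (contraction R F) A]rk_ground.
rewrite -/A' (rk_relaxation_sub sC) //; have := rk_contraction R F A'.
have /andP[sA' dA] : (A' \subset H) && [disjoint A' & F] by rewrite -subsetD.
have cU : #|A' :|: F| = #|A'| + #|F| by apply/eqP; rewrite leq_card_setU.
rewrite [rk R (_ :|: _)]rk_relaxation_sub ?subUset ?sA' // cU; lia.
Qed.

(** * Degree bound and small ranks for Kazhdan-Lusztig polynomials *)

Local Open Scope ring_scope.

Lemma KLpoly_rank0 (T : finType) (M : matroid T) :
  rank M = 0%N -> ground M = set0 -> KLpoly M = 1.
Proof.
move=> r0 E0; have /forallP/(_ M)/and3P[] := xchooseP (KL_exists T).
by rewrite r0 E0 !eqxx => /eqP e _ _; exact: e.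
Qed.

Lemma KLpoly_nth (T : finType) (M : matroid T) i :
  (0 < rank M)%N -> (rank M <= i.*2)%N -> (KLpoly M)`_i = 0.
Proof.
move=> r0; have /forallP/(_ M)/and3P[_ + _] := xchooseP (KL_exists T).
by rewrite r0 => /deg_half_nth; apply.
Qed.

Lemma KLpoly_contraction_ground (T : finType) (M : matroid T) :
  KLpoly (contraction M (ground M)) = 1.
Proof.
apply: KLpoly_rank0; last by rewrite /ground /= setDv.
by have := rank_contraction M (ground M); rewrite -/(rank M); lia.
Qed.

(** Without loops the only flats are the empty set and the ground set, so Z = P + t. The degree
    bound makes P constant, and palindromicity makes it 1. *)
Lemma KLpoly_rank1 (T : finType) (M : matroid T) :
  rank M = 1%N -> set0 \in flats M -> KLpoly M = 1.
Proof.
move=> r1 f0; have /flatP[_ h0] := f0.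
have E0 : ground M != set0.
  by apply/eqP => E0; move: r1; rewrite /rank E0 rk0.
have fE (F : {set T}) : (F \in flats M) && (F != set0) = (F == ground M).
  apply/andP/eqP => [[hF nF]|->]; last by rewrite ground_flat.
  apply: (flat_full_rank hF); apply/eqP; rewrite r1 eqn_leq -{1}r1 rk_le_rank.
  rewrite lt0n; apply: contraNneq nF => rF; rewrite -subset0.
  apply/subsetP => x xF; apply: h0; first exact: (subsetP (flat_sub hF)).
  apply/eqP; rewrite setU0 rk0 -leqn0 -rF rk_sub // sub1set //.
have ZE : Zpoly M = KLpoly M + 'X.
  rewrite /Zpoly (bigD1 set0) //= rk0 contraction0 mul1r; congr (_ + _).
  rewrite (eq_bigl _ _ fE) big_pred1_eq KLpoly_contraction_ground.
  by rewrite -/(rank M) r1 mulr1.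
have P0 i : (KLpoly M)`_i.+1 = 0 by apply: KLpoly_nth; rewrite r1.
have := congr1 (fun p : {poly int} => p`_0) (Zpoly_palindromic M).
rewrite r1 coef_recip /= ZE !coefD !coefX P0 /= addr0 add0r => e.
by apply/polyP => -[|i]; rewrite coef1 ?P0.
Qed.

Lemma KLpoly_contraction_rank1 (T : finType) (M : matroid T) (F : {set T}) :
  F \in flats M -> (rk M F).+1 = rank M -> KLpoly (contraction M F) = 1.
Proof.
move=> hF rF; apply: KLpoly_rank1; first by have := rank_contraction M F; lia.
by rewrite -(setDv F) flats_contraction_sub.
Qed.

(** * The difference of the Z-polynomials *)

Lemma sum_powerset_card (T : finType) (V : nmodType) (H : {set T})
    (P : pred nat) (f : nat -> V) :
  \sum_(F in powerset H | P #|F|) f #|F| =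
  \sum_(j < #|H|.+1 | P j) f j *+ 'C(#|H|, j).
Proof.
rewrite (partition_big (fun F : {set T} => inord #|F| : 'I_#|H|.+1) P) /=;
  last first.
  move=> F; rewrite inE => /andP[/subset_leq_card sF].
  by rewrite inordK.
apply: eq_bigr => j Pj; rewrite -cards_draws -sumr_const.
apply: eq_big => [F|F].
  rewrite !inE; case: (boolP (F \subset H)) => //= /subset_leq_card sF.
  rewrite -val_eqE /= inordK //; case: eqP => [->|]; rewrite ?andbF //.
  by rewrite Pj.
rewrite inE => /andP[/andP[/subset_leq_card sF _] /eqP <-].
by rewrite inordK.
Qed.

(** Flats not inside [H] contribute the same sum [O] to both sides. The binomial term comes from the
    (k - 1)-subsets of [H], flats of [R] whose contractions have P = 1; the subtracted power is the
    contribution of the flat [H] of [M]. *)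
Lemma Zpoly_relaxation (T : finType) (M : matroid T) (H : {set T})
    (sH : stressed_hyperplane M H) :
  Zpoly (relaxation sH) = Zpoly M +
    (\sum_(F in powerset H | (#|F| < (rank M).-1)%N) 'X^#|F| *
       (KLpoly (contraction (relaxation sH) F) - KLpoly (contraction M F)) +
     'X^((rank M).-1) *+ 'C(#|H|, (rank M).-1) - 'X^((rank M).-1)).
Proof.
set R := relaxation sH; set k := rank M; have rH := stressed_rk sH.
have hH := stressed_flat sH.
(* Hence [H] is not among the sets with fewer than k - 1 elements and is split off separately in
   [ZM]. *)
have leH : (k.-1 <= #|H|)%N by have := rk_card M H; rewrite /k; lia.
pose O := \sum_(F in flats M | ~~ (F \subset H))
  'X^(rk M F) * KLpoly (contraction M F).
have ZM : Zpoly M = \sum_(F in powerset H | (#|F| < k.-1)%N)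
    'X^#|F| * KLpoly (contraction M F) + 'X^(k.-1) + O.
  rewrite /Zpoly (bigID (fun F : {set T} => F \subset H)) /=; congr (_ + _).
  rewrite (bigD1 H) ?hH ?subxx //= KLpoly_contraction_rank1 // mulr1 addrC.
  congr (_ + 'X^_); last by rewrite /k -rH.
  apply: eq_big => [F|F /andP[/andP[hF sF] nF]].
    rewrite powersetE; case: (boolP (F \subset H)) => [sF|_]; rewrite ?andbF //=.
    rewrite (flats_stressed_sub sH sF) andbT -/k.
    by case: eqVneq => [->|_] /=; rewrite ?andbT // ltnNge leH.
  rewrite (rk_stressed_sub sH) //.
  by move: hF; rewrite (flats_stressed_sub sH sF) (negPf nF) /=; lia.
have ZR : Zpoly R = \sum_(F in powerset H | (#|F| < k.-1)%N)
    'X^#|F| * KLpoly (contraction R F) + 'X^(k.-1) *+ 'C(#|H|, k.-1) + O.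
  rewrite /Zpoly (bigID (fun F : {set T} => F \subset H)) /=; congr (_ + _); last first.
    apply: eq_big => [F|F /andP[hF nF]].
      case: (boolP (F \subset H)) => [_|nF]; first by rewrite !andbF.
      by rewrite flats_relaxation_out.
    have sF := flat_sub hF; rewrite contraction_relaxation_out //.
    by rewrite rk_relaxation_out // (setIidPr sF).
  rewrite (bigID (fun F : {set T} => (#|F| < k.-1)%N)) /=; congr (_ + _).
    apply: eq_big => [F|F /andP[/andP[hF sF] ltF]].
      rewrite powersetE; case: (boolP (F \subset H)) => [sF|_]; rewrite ?andbF //=.
      rewrite (flats_relaxation_sub sH sF) -/k andbT.
      by case: (ltnP #|F| k.-1) => [/ltnW ->|_]; rewrite ?andbF.
    by rewrite (rk_relaxation_sub sH sF); congr ('X^_ * _); lia.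
  rewrite -cards_draws -sumr_const; apply: eq_big => [F|F].
    rewrite [RHS]inE; case: (boolP (F \subset H)) => [sF|_]; rewrite ?andbF //=.
    by rewrite (flats_relaxation_sub sH sF) -/k andbT -leqNgt eqn_leq.
  move=> /andP[/andP[hF sF] leF].
  have rF : rk R F = k.-1.
    move: hF; rewrite (rk_relaxation_sub sH sF) (flats_relaxation_sub sH sF).
    by rewrite -/k; lia.
  rewrite rF KLpoly_contraction_rank1 ?mulr1 // rF rank_relaxation.
  by rewrite /k; lia.
have cancel (a b c d e : {poly int}) :
  a + c + e = b + d + e + (a - b + c - d) by ring.
rewrite ZM ZR -/k (eq_bigr _ (fun F _ => mulrBr _ _ _)) sumrB.
exact: cancel.
Qed.

(** * Recovering P_R - P_M by palindromicity and induction on the rank *)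

Lemma palindromic_low (k : nat) (D S : {poly int}) :
  (forall i, (k <= i.*2)%N -> D`_i = 0) -> recip k (D + S) = D + S ->
  D = \poly_(i < uphalf k) (S`_(k - i) - S`_i).
Proof.
move=> D0 pal; apply/polyP => i; rewrite coef_poly.
case: ltnP => hi; last by apply: D0; lia.
have := congr1 (fun p : {poly int} => p`_i) pal.
rewrite coef_recip !coefD ifT; last by lia.
(* For i below k/2 the mirror index k - i lies where [D] vanishes, so the coefficient of [S] at k -
   i equals that of [D + S] at i. *)
by rewrite D0 ?add0r => [->|]; [rewrite addrK | lia].
Qed.

Lemma is_gammaD r Z1 Z2 g1 g2 :
  is_gamma r Z1 g1 -> is_gamma r Z2 g2 -> is_gamma r (Z1 + Z2) (g1 + g2).
Proof.
move=> /andP[s1 /eqP e1] /andP[s2 /eqP e2]; apply/andP; split.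
  by rewrite (leq_trans (size_polyD _ _)) // geq_max s1.
apply/eqP; rewrite {1}e1 {1}e2 -big_split; apply: eq_bigr => i _.
by rewrite coefD scalerDl.
Qed.

(* Z_R - Z_M when m = 0, and Z_R - Z_M - (P_R - P_M) when m = 1, provided p k h
   is P_R - P_M in the smaller ranks; the last two terms are the contributions
   of the (k - 1)-subsets of H and of the flat H. *)
Definition Zdiff_from (p : nat -> nat -> {poly int}) (m k h : nat) :=
  \sum_(j < h.+1 | (m <= j < k.-1)%N) ('X^j * p (k - j)%N (h - j)%N) *+ 'C(h, j)
  + 'X^(k.-1) *+ 'C(h, k.-1) - 'X^(k.-1).

(** For rank above 1 the empty set is among the [F] with |F| < k - 1, and all contractions at such
    [F] again have rank above 1. *)
Definition KLdiff_upto (p : nat -> nat -> {poly int}) (n : nat) :=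
  forall (T : finType) (M : matroid T) (H : {set T})
         (sH : stressed_hyperplane M H),
    (1 < rank M <= n)%N ->
    KLpoly (relaxation sH) = KLpoly M + p (rank M) #|H|.

(** Contracting at least [m] independent elements brings a rank of at most [n + m] down to at most
    [n], where [p] is valid. The case [m = 1] serves the induction, [m = 0] the final formula for
    Z. *)
Lemma sum_KLdiff (p : nat -> nat -> {poly int}) (m n : nat) (T : finType)
    (M : matroid T) (H : {set T}) (sH : stressed_hyperplane M H) :
  KLdiff_upto p n -> (rank M <= n + m)%N ->
  \sum_(F in powerset H | (m <= #|F| < (rank M).-1)%N) 'X^#|F| *
     (KLpoly (contraction (relaxation sH) F) - KLpoly (contraction M F)) =
  \sum_(j < #|H|.+1 | (m <= j < (rank M).-1)%N)
     ('X^j * p (rank M - j)%N (#|H| - j)%N) *+ 'C(#|H|, j).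
Proof.
move=> hp le.
rewrite -(sum_powerset_card H (fun j => (m <= j < (rank M).-1)%N)
  (fun j => 'X^j * p (rank M - j)%N (#|H| - j)%N)).
apply: eq_bigr => F /andP[]; rewrite inE => sF /andP[leF ltF].
have ltF' : (#|F| < rank M)%N by lia.
have rF : rank (contraction M F) = (rank M - #|F|)%N.
  by have := rank_contraction M F; rewrite (rk_stressed_sub sH) //; lia.
rewrite (contraction_relaxation_sub sH sF ltF') hp ?rF; last by lia.
by rewrite addrC addKr cardsD (setIidPr sF).
Qed.

Lemma Zpoly_KLdiff (p : nat -> nat -> {poly int}) (n : nat) (T : finType)
    (M : matroid T) (H : {set T}) (sH : stressed_hyperplane M H) :
  KLdiff_upto p n -> (rank M <= n)%N ->
  Zpoly (relaxation sH) = Zpoly M + Zdiff_from p 0 (rank M) #|H|.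
Proof.
move=> hp le; rewrite Zpoly_relaxation /Zdiff_from -(sum_KLdiff sH hp) //.
by rewrite addn0.
Qed.

Lemma KLdiff_exists (n : nat) : exists p, KLdiff_upto p n.
Proof.
elim: n => [|n [p hp]].
  (* No rank is both above 1 and at most 0, so any [p] would do. *)
  by exists (fun _ _ => 0) => T M H sH; lia.
pose low k (S : {poly int}) := \poly_(i < uphalf k) (S`_(k - i) - S`_i).
exists (fun k h => if (k <= n)%N then p k h else low k (Zdiff_from p 1 k h)).
move=> T M H sH /andP[k2 kn]; case: leqP => [le|gt].
  by apply: hp; rewrite k2.
have rR := rank_relaxation sH.
set k := rank M; pose D := KLpoly (relaxation sH) - KLpoly M.
have ZE : Zpoly (relaxation sH) = Zpoly M + (D + Zdiff_from p 1 k #|H|).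
  rewrite Zpoly_relaxation /Zdiff_from -(sum_KLdiff sH hp) ?addn1 //.
  congr (_ + _); rewrite !addrA; congr (_ + _ - _).
  (* The empty set occurs because k > 1, and its term is exactly [D]. *)
  rewrite (bigD1 set0) /=; last by rewrite inE sub0set cards0; lia.
  rewrite cards0 mul1r !contraction0; congr (_ + _).
  by apply: eq_bigl => F; rewrite card_gt0 -andbA; congr (_ && _); rewrite andbC.
rewrite /low -(@palindromic_low k D); first by rewrite /D addrC subrK.
  by move=> i ki; rewrite coefB !KLpoly_nth ?subrr ?rR //; lia.
have := Zpoly_palindromic (relaxation sH); rewrite ZE recipD rR.
by rewrite Zpoly_palindromic => /addrI.
Qed.

(* From Z-polynomials to gamma-polynomials *)
Local Close Scope ring_scope.

Theorem theorem5p8 (k h : nat) (hk : 1 <= k) (hh : 1 <= h) :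
  exists g : {poly int},
    forall (T : finType) (M : matroid T) (H : {set T})
           (sH : stressed_hyperplane M H),
      rank M = k -> #|H| = h ->
      gammapoly (relaxation sH) = (gammapoly M + g)%R.
Proof.
have [p hp] := KLdiff_exists k; pose W := Zdiff_from p 0 k h.
have ZE (T : finType) (M : matroid T) (H : {set T})
    (sH : stressed_hyperplane M H) :
    rank M = k -> #|H| = h -> Zpoly (relaxation sH) = (Zpoly M + W)%R.
  by move=> rM cH; rewrite (Zpoly_KLdiff sH hp) rM ?cH.
(* W is known to be palindromic only if some stressed hyperplane realises (k, h). *)
have [palW|npal] := eqVneq (recip k W) W; last first.
  exists 0%R => T M H sH rM cH; case/eqP: npal.
  have := Zpoly_palindromic (relaxation sH).
  rewrite ZE // recipD rank_relaxation -rM Zpoly_palindromic.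
  by move=> /addrI.
(* [W] is built from k and h alone, hence so is its gamma-polynomial [g]. *)
have [g hg] := gamma_exists palW; exists g => T M H sH rM cH.
apply: (@gamma_unique k (Zpoly (relaxation sH))).
  by rewrite -rM -(rank_relaxation sH); apply: xchooseP.
rewrite ZE //; apply: is_gammaD hg; rewrite -rM; exact: xchooseP.
Qed.
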